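(* Let $B$ and $B'$ be sign-skew-symmetric integer matrices such that their Cartan counterparts $A(B)$ and $A(B')$ are Cartan matrices of finite type. Then the series $\mathcal{A}(B,-)$ and $\mathcal{A}(B',-)$ (over a fixed semifield $\mathbb{P}$) are strongly isomorphic if and only if $A(B)$ and $A(B')$ are of the same Cartan-Killing type.
   Context: Semifields. A semifield $(\mathbb{P},\oplus,\cdot)$ is an abelian multiplicative group with a commutative, associative operation $\oplus$ over which multiplication distributes. Its multiplicative group is torsion-free, so the group ring $\mathbb{Z}\mathbb{P}$ is a domain. Seeds. Fix $\mathbb{P}$ and a rank $n$. The ambient field $\mathcal{F}$ is isomorphic to the field of rational functions in $n$ independent variables with coefficients in $\mathbb{Z}\mathbb{P}$. A seed in $\mathcal{F}$ is a triple $\Sigma=(\mathbf{x},\mathbf{p},B)$ where: $\mathbf{x}\subset\mathcal{F}$ is an $n$-element transcendence basis over the fraction field of $\mathbb{Z}\mathbb{P}$; $\mathbf{p}=(p_x^{\pm})_{x\in\mathbf{x}}$ is a $2n$-tuple of elements of $\mathbb{P}$ satisfying the normalization condition $p_x^+\oplus p_x^-=1$ for all $x$; $B=(b_{xy})_{x,y\in\mathbf{x}}$ is an integer matrix that is sign-skew-symmetric, i.e. for all $x,y$ either $b_{xy}=b_{yx}=0$ or $b_{xy}b_{yx}<0$. Mutations. The matrix mutation in direction $k$ sends $B=(b_{ij})$ to $B'=(b'_{ij})$ with $b'_{ij}=-b_{ij}$ if $i=k$ or $j=k$, and $b'_{ij}=b_{ij}+\frac{|b_{ik}|b_{kj}+b_{ik}|b_{kj}|}{2}$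 otherwise. For a seed $\Sigma$ and $z\in\mathbf{x}$ define $\overline\Sigma=(\overline{\mathbf{x}},\overline{\mathbf{p}},\overline B)$: $\overline{\mathbf{x}}=\mathbf{x}-\{z\}\cup\{\overline z\}$ with $\overline z$ given by the exchange relation $z\overline z=p_z^+\prod_{b_{xz}>0}x^{b_{xz}}+p_z^-\prod_{b_{xz}<0}x^{-b_{xz}}$; $\overline{\mathbf{p}}$ is determined by normalization $\overline p_x^+\oplus\overline p_x^-=1$ and $\overline p_x^+/\overline p_x^-=p_z^-/p_z^+$ if $x=\overline z$, $=(p_z^+)^{b_{zx}}p_x^+/p_x^-$ if $b_{zx}\ge0$, $=(p_z^-)^{b_{zx}}p_x^+/p_x^-$ if $b_{zx}\le0$; $\overline B$ is the matrix mutation of $B$ in direction $z$, with the index $z$ relabeled $\overline z$. If $\overline\Sigma$ is a seed, $\Sigma$ admits a mutation in direction $z$. Cluster algebras. Let $\mathcal{S}$ be a set of seeds in $\mathcal{F}$ such that each seed in $\mathcal S$ admits mutations in all $n$ directions, with results in $\mathcal{S}$, and any two seeds in $\mathcal{S}$ are related by a sequence of mutations. The sets $\mathbf{x}$ are clusters, their elements cluster variables; $\mathcal{X}$ is the set of all cluster variables and $\mathcal{P}$ the set of all $p_x^\pm$ over all seeds in $\mathcal{S}$. The cluster algebra $\mathcal{A}(\mathcal{S})$ is the $\mathbb{Z}[\mathcal{P}]$-subalgebra of $\mathcal{F}$ generated by $\mathcal{X}$. $\mathcal{A}(\mathcal{S})\subset\mathcal{F}$ and $\mathcal{A}(\mathcal{S}')\subset\mathcal{F}'$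 over the same $\mathbb{P}$ are strongly isomorphic if some $\mathbb{Z}\mathbb{P}$-algebra isomorphism $\mathcal{F}\to\mathcal{F}'$ transports some (equivalently, any) seed of $\mathcal{S}$ to a seed of $\mathcal{S}'$. Up to strong isomorphism, the algebra is determined by $B$ and $\mathbf{p}$ of any one seed and is denoted $\mathcal{A}(B,\mathbf{p})$; it is defined if and only if every matrix obtained from $B$ by a sequence of mutations is sign-skew-symmetric (in particular if $B$ is skew-symmetrizable, which holds when $A(B)$ is a Cartan matrix of finite type). Series. The series $\mathcal{A}(B,-)$ consists of all $\mathcal{A}(B,\mathbf{p})$ with $B$ fixed and $\mathbf{p}$ varying over all $2n$-tuples satisfying the normalization conditions. Two series $\mathcal{A}(B,-)$, $\mathcal{A}(B',-)$ are strongly isomorphic if there is a bijection sending each $\mathcal{A}(B,\mathbf{p})$ to a strongly isomorphic $\mathcal{A}(B',\mathbf{p}')$; this amounts to $B$ and $B'$ being obtained from each other by a sequence of matrix mutations, modulo simultaneous relabeling of rows and columns. Cartan counterpart. For an integer square matrix $B=(b_{ij})$, $A(B)=(a_{ij})$ is given by $a_{ii}=2$ and $a_{ij}=-|b_{ij}|$ for $i\ne j$. Cartan matrices of finite type need not be indecomposable. *)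

(* Defs.v *)
From HB Require Import structures.
From mathcomp Require Import all_boot all_order all_algebra.
From mathcomp Require Import finmap boolp mpoly.
From mathcomp Require monalg.
Set Implicit Arguments.
Unset Strict Implicit.
Unset Printing Implicit Defensive.
Import Order.TTheory GRing.Theory Num.Theory.
Local Open Scope ring_scope.

HB.mixin Record Group_isSemifield P of Group P := {
  semifield_mulC : forall x y : P, (x * y)%g = (y * x)%g;
  oplus : P -> P -> P;
  oplusC : commutative oplus;
  oplusA : associative oplus;
  mulg_oplusr : forall x y z : P,
    (x * oplus y z)%g = oplus (x * y)%g (x * z)%g
}.

#[short(type="semifieldType")]
HB.structure Definition Semifield := { P of Group P & Group_isSemifield P }.

Section SemifieldTheory.
Variable P : semifieldType.
Implicit Types (x y c : P) (C : P -> Prop).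

Lemma semifield_torsion_free x m : (0 < m)%N -> (x ^+ m)%g = 1%g -> x = 1%g.
Proof.
case: m => // -[|m] _; first by rewrite expg1.
have [u Hu] : exists u, (x * oplus 1 u)%g = oplus u (x ^+ m.+2)%g.
  elim: m => [|m [u Hu]].
    by exists x; rewrite mulg_oplusr mulg1 expg2.
  exists (oplus u (x ^+ m.+2)%g).
  by rewrite oplusA mulg_oplusr Hu [in RHS]expgS.
move=> xm; rewrite xm oplusC in Hu.
by apply: (@mulIg _ (oplus u 1%g)); rewrite mul1g Hu oplusC.
Qed.

(* Finitely many elements of a torsion-free abelian group are pairwise comparable
   for the order of a suitable pointed cone; comparing leading terms then shows
   that the group ring is a domain. *)
Definition cone C := [/\ C 1%g, forall x y, C x -> C y -> C (x * y)%g &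
  forall x, C x -> C x^-1%g -> x = 1%g].

Lemma coneX C x m : cone C -> C x -> C (x ^+ m)%g.
Proof.
by case=> C1 CM _ Cx; elim: m => [|m IH]; rewrite ?expg0 // expgS; apply: CM.
Qed.

Lemma semifield_mulACA (a b c d : P) : (a * b * (c * d) = a * c * (b * d))%g.
Proof. by rewrite -mulgA (mulgA b) (semifield_mulC b) -mulgA mulgA. Qed.

Definition cone_adjoin C x y := exists2 c, C c & exists m, y = (c * x ^+ m)%g.

Lemma cone_adjoinP C x : cone C ->
  cone (cone_adjoin C x) \/ (exists e m, [/\ C e, (0 < m)%N & (e * x ^+ m)%g = 1%g]).
Proof.
move=> CC; have [C1 CM CP] := CC.
have [[e [m [Ce m0 He]]]|nE] :=
  pselect (exists e m, [/\ C e, (0 < m)%N & (e * x ^+ m)%g = 1%g]).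
  by right; exists e, m.
left; split.
- by exists 1%g => //; exists 0; rewrite expg0 mulg1.
- move=> _ _ [c Cc [i ->]] [d Cd [j ->]]; exists (c * d)%g; first exact: CM.
  by exists (i + j)%N; rewrite expgnDr semifield_mulACA.
move=> _ [c Cc [i ->]] [d Cd [j E]].
have E1 : (c * d * x ^+ (i + j) = 1)%g.
  by rewrite expgnDr semifield_mulACA -E mulgV.
case: (posnP (i + j)%N) => [/eqP|ij0]; last first.
  by case: nE; exists (c * d)%g, (i + j)%N; split => //; exact: CM.
rewrite addn_eq0 => /andP[/eqP i0 /eqP j0]; move: E1.
rewrite i0 j0 expg0 !mulg1 => E1; apply: CP => //.
by rewrite (mulg1_eq E1).
Qed.

Lemma cone_exists (L : seq P) :
  exists2 C, cone C & forall x, x \in L -> C x \/ C x^-1%g.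
Proof.
elim: L => [|x L [C CC CL]].
  by exists (fun x => x = 1%g) => //; split => // x y -> ->; rewrite mulg1.
have [C1 CM CP] := CC.
have inC z y : C y -> cone_adjoin C z y.
  by move=> Cy; exists y => //; exists 0; rewrite expg0 mulg1.
have inx z : cone_adjoin C z z by exists 1%g => //; exists 1%N; rewrite mul1g.
case: (cone_adjoinP x CC) => [Cx|[e [m [Ce m0 Ee]]]].
  exists (cone_adjoin C x) => // y; rewrite in_cons => /orP[/eqP ->|/CL].
    by left.
  by case=> ?; [left|right]; exact: inC.
case: (cone_adjoinP x^-1%g CC) => [Cx|[f [k [Cf k0 Ef]]]].
  exists (cone_adjoin C x^-1%g) => // y; rewrite in_cons => /orP[/eqP ->|/CL].
    by right.
  by case=> ?; [left|right]; exact: inC.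
have x1 : x = 1%g.
  apply: (@semifield_torsion_free x (m * k)); first by rewrite muln_gt0 m0.
  have fE : f = (x ^+ k)%g.
    by apply/divg1_eq; rewrite -Ef expVgn.
  have eE : e = (x ^- m)%g by apply/eqP; rewrite -mulg_eq1 Ee.
  apply: CP; first by rewrite mulnC expgnA -fE; exact: coneX.
  by rewrite expgnA -expVgn -eE; exact: coneX.
exists C => // y; rewrite in_cons => /orP[/eqP ->|/CL //].
by left; rewrite x1.
Qed.

Lemma cone_max C (s : seq P) : cone C -> s != [::] ->
  (forall x y, x \in s -> y \in s -> C (x / y)%g \/ C (y / x)%g) ->
  exists2 m, m \in s & forall x, x \in s -> C (m / x)%g.
Proof.
move=> [C1 CM CP]; elim: s => // x s IH _ tot.
have [->|sN] := eqVneq s [::].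
  by exists x; rewrite ?mem_head // => y; rewrite inE => /eqP ->; rewrite mulgV.
have [|m ms Hm] := IH sN.
  by move=> y z ys zs; apply: tot; rewrite in_cons ?ys ?zs orbT.
have [mx|xm] : C (m / x)%g \/ C (x / m)%g.
  by apply: tot; rewrite in_cons ?ms ?eqxx ?orbT.
- exists m; first by rewrite in_cons ms orbT.
  by move=> y; rewrite in_cons => /orP[/eqP ->|/Hm].
- exists x; first exact: mem_head.
  move=> y; rewrite in_cons => /orP[/eqP ->|/Hm]; first by rewrite mulgV.
  by move=> /(CM _ _ xm); rewrite mulgA mulgVK.
Qed.

End SemifieldTheory.

Definition groupring (P : semifieldType) : Type := monalg.malg P int.

Section GroupRing.
Import finmap monalg.
Local Open Scope fset_scope.
Variable P : semifieldType.

HB.instance Definition _ := GRing.Zmodule.on (groupring P).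

Implicit Types (g : groupring P) (k : P) (c : int).

Definition gr_one : groupring P := mkmalgU (1%g : P) 1.

Definition gr_mul g1 g2 : groupring P :=
  \sum_(k1 <- msupp g1) \sum_(k2 <- msupp g2)
    mkmalgU (k1 * k2)%g (mcoeff k1 g1 * mcoeff k2 g2).

Lemma gr_mulw (d1 d2 : {fset P}) g1 g2 :
  msupp g1 `<=` d1 -> msupp g2 `<=` d2 ->
  gr_mul g1 g2 = \sum_(k1 <- d1) \sum_(k2 <- d2)
    mkmalgU (k1 * k2)%g (mcoeff k1 g1 * mcoeff k2 g2).
Proof.
move=> le_d1 le_d2; rewrite /gr_mul (big_fset_incl _ le_d1) /=.
  apply/eq_bigr => k1 _; apply/big_fset_incl => // k _ /mcoeff_outdom ->.
  by rewrite mulr0 monalgU0.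
move=> k _ /mcoeff_outdom g1k.
by rewrite big1 => // k' _; rewrite g1k mul0r monalgU0.
Qed.

Lemma gr_mulC : commutative gr_mul.
Proof.
move=> g1 g2; rewrite /gr_mul exchange_big; apply/eq_bigr => k2 _.
by apply/eq_bigr => k1 _; rewrite semifield_mulC mulrC.
Qed.

Lemma gr_mul0 : left_zero 0 gr_mul.
Proof. by move=> g; rewrite /gr_mul msupp0 big_seq_fset0. Qed.

Lemma gr_mulUU c1 c2 k1 k2 :
  gr_mul (mkmalgU k1 c1) (mkmalgU k2 c2) = mkmalgU (k1 * k2)%g (c1 * c2).
Proof. by rewrite (gr_mulw msuppU_le msuppU_le) !big_seq_fset1 !mcoeffUU. Qed.

Lemma gr_mul1 : left_id gr_one gr_mul.
Proof.
move=> g; rewrite (gr_mulw msuppU_le (fsubset_refl _)) big_seq_fset1.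
rewrite [RHS]monalgE; apply/eq_bigr => k _.
by rewrite mcoeffUU mul1r mul1g.
Qed.

Lemma gr_mulDl : left_distributive gr_mul +%R.
Proof.
move=> g1 g2 g.
rewrite (gr_mulw (msuppD_le g1 g2) (fsubset_refl _)).
rewrite (gr_mulw (fsubsetUl _ (msupp g2)) (fsubset_refl _)).
rewrite (gr_mulw (fsubsetUr (msupp g1) _) (fsubset_refl _)).
rewrite -big_split /=; apply/eq_bigr => k1 _.
rewrite -big_split /=; apply/eq_bigr => k2 _.
by rewrite mcoeffD mulrDl monalgUD.
Qed.

Lemma gr_mulE1 g1 g2 :
  gr_mul g1 g2 = \sum_(k1 <- msupp g1) gr_mul (mkmalgU k1 (mcoeff k1 g1)) g2.
Proof.
apply/eq_bigr => k _; rewrite (gr_mulw msuppU_le (fsubset_refl _)).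
by rewrite big_seq_fset1 mcoeffUU.
Qed.

Lemma gr_mulA : associative gr_mul.
Proof.
have suml I r (F : I -> groupring P) g :
    gr_mul (\sum_(i <- r) F i) g = \sum_(i <- r) gr_mul (F i) g.
  exact: (big_morph (gr_mul^~ g) (fun a b => gr_mulDl a b g) (gr_mul0 g)).
have sumr I r (F : I -> groupring P) g :
    gr_mul g (\sum_(i <- r) F i) = \sum_(i <- r) gr_mul g (F i).
  by rewrite gr_mulC suml; apply: eq_bigr => i _; rewrite gr_mulC.
move=> g1 g2 g3; rewrite [gr_mul g1 g2]/gr_mul suml gr_mulE1.
apply: eq_bigr => k1 _; rewrite suml [gr_mul g2 g3]/gr_mul sumr.
apply: eq_bigr => k2 _; rewrite [g3 in RHS]monalgE !sumr.
by apply: eq_bigr => k3 _; rewrite !gr_mulUU mulrA mulgA.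
Qed.

Lemma gr_one_neq0 : gr_one != 0.
Proof. by rewrite monalgU_eq0. Qed.

HB.instance Definition _ := GRing.Zmodule_isComNzRing.Build (groupring P)
  gr_mulA gr_mulC gr_mul1 gr_mulDl gr_one_neq0.

Lemma gr_integral g1 g2 : g1 * g2 = 0 -> (g1 == 0) || (g2 == 0).
Proof.
have supp0 g : (g != 0) -> (msupp g : seq P) != [::].
  apply: contra_neq => E; rewrite [g]monalgE.
  by rewrite E big_nil.
have [//|/supp0 n1] := eqVneq g1 0; have [//|/supp0 n2] := eqVneq g2 0 => E.
pose quot (s : seq P) := [seq (x / y)%g | x <- s, y <- s].
have [C CC tot] := cone_exists (quot (msupp g1) ++ quot (msupp g2)).
have [|m1 s1 max1] := cone_max CC n1.
  move=> x y xs ys; case: (tot (x / y)%g); rewrite ?invgF; [|by left|by right].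
  by rewrite mem_cat; apply/orP; left; apply/allpairsP; exists (x, y).
have [|m2 s2 max2] := cone_max CC n2.
  move=> x y xs ys; case: (tot (x / y)%g); rewrite ?invgF; [|by left|by right].
  by rewrite mem_cat; apply/orP; right; apply/allpairsP; exists (x, y).
have [_ _ CP] := CC.
have uniq k1 k2 : k1 \in msupp g1 -> k2 \in msupp g2 ->
    (k1 * k2)%g = (m1 * m2)%g -> k1 = m1 /\ k2 = m2.
  move=> /max1 c1 /max2 c2 e.
  have e1 : (m1 / k1 * (m2 / k2))%g = 1%g.
    by rewrite semifield_mulACA -e semifield_mulACA !mulgV mulg1.
  have e2 : (m1 / k1)%g = 1%g by apply: CP => //; rewrite (mulg1_eq e1).
  move: e1; rewrite e2 mul1g => e1.
  by split; apply/esym/divg1_eq.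
have /eqP : mcoeff (m1 * m2)%g (g1 * g2) = mcoeff m1 g1 * mcoeff m2 g2.
  rewrite raddf_sum /= (big_fsetD1 m1) //= raddf_sum /= (big_fsetD1 m2) //=.
  rewrite mcoeffUU big1_fset ?addr0 => [|k2 k2s _]; last first.
    move: k2s; rewrite !inE => /andP[k2m k2s]; rewrite mcoeffU.
    by case: eqP => // /(uniq _ _ s1 k2s) [_ k2E]; rewrite k2E eqxx in k2m.
  rewrite big1_fset ?addr0 // => k1 k1s _.
  move: k1s; rewrite !inE => /andP[k1m k1s].
  rewrite raddf_sum /= big1_fset // => k2 k2s _; rewrite mcoeffU.
  by case: eqP => // /(uniq _ _ k1s k2s) [k1E _]; rewrite k1E eqxx in k1m.
by rewrite E mcoeff0 eq_sym mulf_eq0 !mcoeff_eq0 s1 s2.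
Qed.

Definition gr_unit : pred (groupring P) := fun g => `[< exists h, h * g = 1 >].

Definition gr_inv g : groupring P :=
  if pselect (exists h, h * g = 1) is left E then projT1 (cid E) else g.

Lemma gr_mulV : {in gr_unit, left_inverse 1 gr_inv *%R}.
Proof.
move=> g /asboolP ug; rewrite /gr_inv; case: pselect => // E.
by case: cid.
Qed.

Lemma gr_unitPl g1 g2 : g2 * g1 = 1 -> gr_unit g1.
Proof. by move=> E; apply/asboolP; exists g2. Qed.

Lemma gr_inv_out : {in [predC gr_unit], gr_inv =1 id}.
Proof.
move=> g ug; rewrite /gr_inv; case: pselect => // E.
by move: ug; rewrite inE => /asboolP.
Qed.

HB.instance Definition _ := GRing.ComNzRing_hasMulInverse.Build (groupring P)
  gr_mulV gr_unitPl gr_inv_out.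
HB.instance Definition _ :=
  GRing.ComUnitRing_isIntegral.Build (groupring P) gr_integral.

End GroupRing.

(* The basis element of the group ring attached to p. *)
Definition gr_of (P : semifieldType) (p : P) : groupring P :=
  monalg.mkmalgU p 1.

Lemma gr_ofM (P : semifieldType) (p q : P) : gr_of (p * q)%g = gr_of p * gr_of q.
Proof. by rewrite /gr_of -[RHS]/(gr_mul _ _) gr_mulUU mulr1. Qed.

(* K = Frac(ZP) and F = K(X_1, ..., X_n), which is also Frac(ZP[X_1, ..., X_n]).
   All the notions below are invariant under isomorphisms of ambient fields, so
   this model of the ambient field is used throughout. *)
Definition coefField (P : semifieldType) := {fraction groupring P}.
Definition ambient (P : semifieldType) (n : nat) :=
  {fraction {mpoly (coefField P)[n]}}.

Section Ambient.
Variables (P : semifieldType) (n : nat).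
Local Notation K := (coefField P).
Local Notation F := (ambient P n).

Definition constK (c : K) : F := FracField.tofrac (mpolyC n c).
Definition constZP (c : groupring P) : F := constK (FracField.tofrac c).
Definition constP (p : P) : F := constZP (gr_of p).
Definition ambient_var (i : 'I_n) : F := FracField.tofrac ('X_i : {mpoly K[n]}).

Definition evalK (x : {ffun 'I_n -> F}) (q : {mpoly K[n]}) : F :=
  mmap constK x q.

Definition algebraically_independent (x : {ffun 'I_n -> F}) : Prop :=
  forall q : {mpoly K[n]}, evalK x q = 0 -> q = 0.

Definition generated_subfield (x : {ffun 'I_n -> F}) (u : F) : Prop :=
  exists g h : {mpoly K[n]}, evalK x h != 0 /\ u = evalK x g / evalK x h.

Definition algebraic_over (E : F -> Prop) (u : F) : Prop :=
  exists q : {poly F}, [/\ q != 0, forall i, E q`_i & root q u].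

Definition transcendence_basis (x : {ffun 'I_n -> F}) : Prop :=
  algebraically_independent x /\
  forall u : F, algebraic_over (generated_subfield x) u.

End Ambient.

Section Matrices.
Variable n : nat.
Implicit Types (A B : 'M[int]_n) (k : 'I_n).

(* The case i = j forces a zero diagonal. *)
Definition sign_skew_symmetric B : Prop :=
  forall i j, (B i j = 0 /\ B j i = 0) \/ B i j * B j i < 0.

(* The numerator is always even, so the integer quotient is exact. *)
Definition matrix_mutation k B : 'M[int]_n := \matrix_(i, j)
  if (i == k) || (j == k) then - B i j
  else B i j + ((`|B i k| * B k j + B i k * `|B k j|) %/ 2)%Z.

Definition cartan_counterpart B : 'M[int]_n :=
  \matrix_(i, j) if i == j then 2 else - `|B i j|.

Definition generalized_cartan_matrix A : Prop :=
  [/\ forall i, A i i = 2,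
      forall i j, i != j -> A i j <= 0 &
      forall i j, A i j = 0 -> A j i = 0].

(* Symmetrizable with positive definite symmetrization D A; A need not be
   indecomposable. *)
Definition finite_type A : Prop :=
  generalized_cartan_matrix A /\
  exists d : 'rV[int]_n,
    let S := diag_mx d *m A in
    [/\ forall i, 0 < d 0 i,
        S^T = S &
        forall v : 'cV[rat]_n, v != 0 ->
          0 < (v^T *m map_mx intr S *m v) 0 0].

End Matrices.

(* The Cartan-Killing type of a Cartan matrix of finite type is the isomorphism
   class of its Dynkin diagram (with multiplicities and arrows), and a
   diagram isomorphism is a bijection of the index sets that carries the
   entries of one matrix to those of the other. *)
Definition same_cartan_killing_type (n n' : nat)
    (A : 'M[int]_n) (A' : 'M[int]_n') : Prop :=
  exists2 s : 'I_n -> 'I_n', bijective s &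
    forall i j, A' (s i) (s j) = A i j.

Definition normalized (P : semifieldType) (n : nat)
    (p : {ffun 'I_n -> P * P}) : bool :=
  [forall i, oplus (p i).1 (p i).2 == 1%g].

(* Labeled seeds; a seed in the sense of an n-element set x with data indexed by
   x is a labeled seed up to [relabeling] below. *)
Record seed (P : semifieldType) (n : nat) := Seed {
  cluster : {ffun 'I_n -> ambient P n};
  coefs : {ffun 'I_n -> P * P};   (* i |-> (p_i^+, p_i^-) *)
  exchange_matrix : 'M[int]_n
}.

Definition is_seed (P : semifieldType) (n : nat) (S : seed P n) : Prop :=
  [/\ transcendence_basis (cluster S),
      normalized (coefs S) &
      sign_skew_symmetric (exchange_matrix S)].

(* S' is the image of S under f, as unlabeled seeds. *)
Definition transports (P : semifieldType) (n n' : nat)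
    (f : ambient P n -> ambient P n') (S : seed P n) (S' : seed P n') : Prop :=
  exists2 s : 'I_n -> 'I_n', bijective s &
    [/\ forall i, cluster S' (s i) = f (cluster S i),
        forall i, coefs S' (s i) = coefs S i &
        forall i j, exchange_matrix S' (s i) (s j) = exchange_matrix S i j].

Section Seeds.
Variables (P : semifieldType) (n : nat).
Implicit Types (S : seed P n) (k : 'I_n).

Definition relabeling S S' : Prop := transports id S S'.

(* The element replacing the k-th one keeps the label k. *)
Definition mutation k S S' : Prop :=
  let: Seed x p B := S in
  let: Seed x' p' B' := S' in
  [/\ forall i, i != k -> x' i = x i,
      x k * x' k =
        constP n (p k).1 * \prod_(i | 0 < B i k) x i ^+ `|B i k|%N
        + constP n (p k).2 * \prod_(i | B i k < 0) x i ^+ `|B i k|%N,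
      normalized p',
      forall i, ((p' i).1 / (p' i).2)%g =
        if i == k then ((p k).2 / (p k).1)%g
        else if 0 <= B k i then ((p k).1 ^+ `|B k i|%N * ((p i).1 / (p i).2))%g
        else ((p k).2 ^- `|B k i|%N * ((p i).1 / (p i).2))%g &
      B' = matrix_mutation k B].

Inductive mutation_related S : seed P n -> Prop :=
  | mutation_related_relabel S' : relabeling S S' -> mutation_related S S'
  | mutation_related_step S' S'' k :
      mutation_related S S' -> is_seed S'' -> mutation k S' S'' ->
      mutation_related S S''.

(* A set of seeds as in the definition of a cluster algebra; as sets of labeled
   seeds, they are closed under relabeling. *)
Record seed_class := SeedClass {
  seed_of :> seed P n -> Prop;
  seed_ofP : forall S, seed_of S -> is_seed S;
  seed_of_relabel : forall S S', seed_of S -> relabeling S S' -> seed_of S';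
  seed_of_mutation : forall S k, seed_of S ->
    exists2 S', mutation k S S' & seed_of S';
  seed_of_related : forall S S', seed_of S -> seed_of S' ->
    mutation_related S S'
}.

(* The subring generated by all coefficients and all cluster variables, i.e. the
   subalgebra generated by the cluster variables over the subring generated by
   the coefficients. Strong isomorphism of cluster algebras is defined through
   their sets of seeds, hence is stated on C below. *)
Inductive cluster_algebra (C : seed_class) : ambient P n -> Prop :=
  | cluster_algebra_one : cluster_algebra C 1
  | cluster_algebra_coef1 S i : C S ->
      cluster_algebra C (constP n (coefs S i).1)
  | cluster_algebra_coef2 S i : C S ->
      cluster_algebra C (constP n (coefs S i).2)
  | cluster_algebra_var S i : C S -> cluster_algebra C (cluster S i)
  | cluster_algebra_sub u v :
      cluster_algebra C u -> cluster_algebra C v -> cluster_algebra C (u - v)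
  | cluster_algebra_mul u v :
      cluster_algebra C u -> cluster_algebra C v -> cluster_algebra C (u * v).

Definition initial_seed (B : 'M[int]_n) (p : {ffun 'I_n -> P * P}) : seed P n :=
  Seed [ffun i => ambient_var P i] p B.

(* C is the set of seeds of A(B, p). It is unique if it exists, and then consists
   of all the seeds obtained from the initial one by mutations; the initial
   cluster freely generates the ambient field, which makes A(B, p) well defined
   up to strong isomorphism. *)
Definition defines_cluster_algebra B p (C : seed_class) : Prop :=
  C (initial_seed B p).

End Seeds.

Definition strongly_isomorphic (P : semifieldType) (n n' : nat)
    (C : seed_class P n) (C' : seed_class P n') : Prop :=
  exists f : {rmorphism ambient P n -> ambient P n'},
    [/\ bijective f,
        forall c : groupring P, f (constZP n c) = constZP n' c &
        exists S S', [/\ C S, C' S' & transports f S S']].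

(* The series A(B,-) is the family of the A(B, p) indexed by all normalized p. *)
Definition series_strongly_isomorphic (P : semifieldType) (n n' : nat)
    (B : 'M[int]_n) (B' : 'M[int]_n') : Prop :=
  exists2 phi : {p : {ffun 'I_n -> P * P} | normalized p} ->
                {p : {ffun 'I_n' -> P * P} | normalized p},
    bijective phi &
    forall p, exists (C : seed_class P n) (C' : seed_class P n'),
      [/\ defines_cluster_algebra B (val p) C,
          defines_cluster_algebra B' (val (phi p)) C' &
          strongly_isomorphic C C'].

(* Main.v *)
Require Import Defs.
From HB Require Import structures.
From mathcomp Require Import all_boot all_order all_algebra.
From mathcomp Require Import generic_quotient boolp mpoly.
From mathcomp Require Import zify ring.

(** Isomorphic series have exchange matrices that are related by mutations and
relabeling, and mutations of matrices induce isomorphisms of series. So the theorem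
says that two sign-skew-symmetric matrices whose Cartan counterparts are of finite
type are mutation equivalent if and only if these Cartan matrices agree up to
relabeling.

If the Cartan counterparts agree, then, after relabeling, B and B' differ by
signs only, i.e. they are two orientations of the same diagram. A Cartan matrix
of finite type is a forest: testing positivity on the indicator vector of a set
of vertices produces a vertex with at most one neighbour in that set
([leaf_exists]). By induction on leaves, any two orientations of a forest are
related by reversing all arrows at sinks and sources ([flips_connect]), and at a
sink or a source this is a matrix mutation. A mutation acts bijectively on
normalized coefficients, so it transports a whole series
([coefficient_transfer]). What remains is that the cluster algebras exist. Every
cluster that is reached from the initial one is the image of the variables under
an automorphism of the ambient field that fixes the coefficients, because
replacing X_k by M / X_k, with M free of X_k, is an involution
([free_cluster_involution]); hence it is a transcendence basis. As mutation is
moreover involutive, the seeds reached from the initial one form a class of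
seeds ([mutation_class]).

If the series are isomorphic, B and B' are related by mutations. Let L be the
lattice with the positive definite form given by the symmetrization of A(B). We
carry a basis of roots of L along the mutations, replacing each basis root b_i
with b_ik > 0 by its reflection in b_k. The Gram-Cartan matrix of this basis stays
congruent modulo 2 to the current exchange matrix ([root_companion_mutation]):
modulo 2 the signs of the exchange matrix are irrelevant, so that nothing has to
be known about oriented cycles. When B' is reached, both the Gram-Cartan matrix
and A(B') are positive and have the same symmetrizer, so the products of
opposite entries are less than 4; together with the parities this determines the
absolute values of the entries ([companion_entry]), and the signs are adjusted
along the forest ([signs_exist]). Thus L has a second basis, whose Cartan matrix
is A(B'). Finally, two such bases are conjugate under the Weyl group: a root has
coordinates of constant sign in each of them ([root_sign_coherent]), and
reflecting one basis brings its dominant vector closer and closer to the dominant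
vector of the other one until the transition matrix and its inverse are both
nonnegative ([lattice_isometry_nonneg]), hence permutation matrices
([lattice_isometry_cartan_type]). *)

Set Implicit Arguments.
Unset Strict Implicit.
Unset Printing Implicit Defensive.
Import Order.TTheory GRing.Theory Num.Theory.
Local Open Scope ring_scope.

(** * Substitutions in fields of rational functions *)

Section FractionLift.
Variables (R : idomainType) (L : fieldType) (phi : {rmorphism R -> L}).
Local Notation tofrac := (@FracField.tofrac R).

Lemma fractionP (x : {fraction R}) :
  exists a b, b != 0 /\ x = tofrac a / tofrac b.
Proof.
elim/quotW: x => x; exists (frac x).1, (frac x).2.
split; first exact: denom_ratioP.
have x0 : tofrac (frac x).2 != 0 by rewrite tofrac_eq0 denom_ratioP.
apply: (mulIf x0).
rewrite divfK //.
unlock FracField.tofrac.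
rewrite -[LHS]FracField.pi_mul /FracField.mulf /= !numden_Ratio ?oner_neq0 //.
apply/eqmodP; rewrite /= FracField.equivfE.
by rewrite !numden_Ratio ?oner_eq0 ?mulr1 ?denom_ratioP // [eqbLHS]mulrC.
Qed.

Hypothesis phi_inj : forall a, phi a = 0 -> a = 0.

(** The extension to the fraction field of a morphism with trivial kernel. The
representatives are chosen by description; [frac_liftE] shows that the choice is
irrelevant. *)
Definition frac_lift (x : {fraction R}) : L :=
  let a := projT1 (cid (fractionP x)) in
  let b := projT1 (cid (projT2 (cid (fractionP x)))) in phi a / phi b.

Let phi_neq0 b : b != 0 -> phi b != 0.
Proof. by apply: contraNneq => /phi_inj ->. Qed.

Lemma frac_liftE a b : b != 0 -> frac_lift (tofrac a / tofrac b) = phi a / phi b.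
Proof.
move=> b0; rewrite /frac_lift; case: cid => c Ec; case: cid => d [d0 /= E].
apply/eqP; rewrite eqr_div ?phi_neq0 // -!rmorphM; apply/eqP; congr (phi _).
apply/eqP; rewrite -tofrac_eq !tofracM -eqr_div ?tofrac_eq0 //; exact/eqP/esym.
Qed.

Lemma frac_lift_tofrac a : frac_lift (tofrac a) = phi a.
Proof.
by rewrite -[tofrac a]divr1 -tofrac1 frac_liftE ?oner_neq0 // rmorph1 divr1.
Qed.

Lemma frac_lift_zmod : zmod_morphism frac_lift.
Proof.
move=> x y; have [a [b [b0 ->]]] := fractionP x.
have [c [d [d0 ->]]] := fractionP y.
have bd0 : b * d != 0 by rewrite mulf_neq0.
rewrite -mulNr addf_div ?tofrac_eq0 // -rmorphN -!rmorphM -rmorphD !frac_liftE //.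
by rewrite rmorphD !rmorphM rmorphN -mulNr addf_div ?phi_neq0.
Qed.

Lemma frac_lift_monoid : monoid_morphism frac_lift.
Proof.
split; first by rewrite -tofrac1 frac_lift_tofrac rmorph1.
move=> x y; have [a [b [b0 ->]]] := fractionP x.
have [c [d [d0 ->]]] := fractionP y.
have bd0 : b * d != 0 by rewrite mulf_neq0.
by rewrite mulf_div -!rmorphM !frac_liftE // !rmorphM mulf_div.
Qed.

HB.instance Definition _ :=
  GRing.isZmodMorphism.Build {fraction R} L frac_lift frac_lift_zmod.
HB.instance Definition _ :=
  GRing.isMonoidMorphism.Build {fraction R} L frac_lift frac_lift_monoid.

Definition frac_lift_rmorphism : {rmorphism {fraction R} -> L} := frac_lift.

End FractionLift.

Lemma mpoly_ring_ind (n : nat) (R : comNzRingType) (Q : {mpoly R[n]} -> Prop) :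
  (forall c, Q (mpolyC n c)) -> (forall i, Q 'X_i) ->
  (forall p q, Q p -> Q q -> Q (p + q)) ->
  (forall p q, Q p -> Q q -> Q (p * q)) -> forall p, Q p.
Proof.
move=> QC QX QD QM; apply: mpolyind => [|c m p _ _ Qp]; first exact: (QC 0).
apply: (QD) => //; rewrite -mul_mpolyC; apply: (QM) => //; rewrite mpolyXE_id.
apply: big_ind => //; first exact: (QC 1).
move=> i _; elim: (m i) => [|e IH]; first exact: (QC 1).
by rewrite exprS; exact: QM.
Qed.

Section ClearDenominators.
Variables (R1 R2 : idomainType) (L1 L2 : fieldType).
Variables (a1 : {rmorphism R1 -> L1}) (a2 : {rmorphism R2 -> L2}).
Variables (phi : {rmorphism R1 -> L2}) (psi : {rmorphism R2 -> L1}).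

(** Read [a1] and [a2] as the embeddings of two polynomial rings in their fraction
fields, and [phi] and [psi] as two substitutions. Formally, [phi q] equals g / u
and the substitution [psi] takes g / u back to q. This says that [psi] inverts
[phi] without having to apply [psi] to a fraction, which would presuppose that
[psi] is injective. *)
Definition clears_denominators (q : R1) : Prop :=
  exists g u : R2,
    [/\ u != 0, psi u != 0, phi q * a2 u = a2 g & psi g = a1 q * psi u].

Lemma clears_denominatorsD p q :
  clears_denominators p -> clears_denominators q -> clears_denominators (p + q).
Proof.
move=> [g [u [u0 yu0 E1 E2]]] [h [v [v0 yv0 E3 E4]]].
exists (g * v + h * u), (u * v); rewrite mulf_neq0 // rmorphM mulf_neq0 //.
split=> //.
  rewrite !(rmorphD, rmorphM) -E1 -E3 mulrDl !mulrA; congr (_ + _).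
  by rewrite mulrAC.
rewrite !(rmorphD, rmorphM) E2 E4 mulrDl !mulrA; congr (_ + _).
by rewrite mulrAC.
Qed.

Lemma clears_denominatorsM p q :
  clears_denominators p -> clears_denominators q -> clears_denominators (p * q).
Proof.
move=> [g [u [u0 yu0 E1 E2]]] [h [v [v0 yv0 E3 E4]]].
exists (g * h), (u * v); rewrite mulf_neq0 // rmorphM mulf_neq0 //.
by split=> //; rewrite !rmorphM -?E1 -?E3 ?E2 ?E4 mulrACA.
Qed.

End ClearDenominators.

Lemma coef_XsubC (L : fieldType) (u : L) i :
  ('X - u%:P)`_i = if i is 0 then - u else (i == 1)%:R.
Proof. by rewrite coefB coefX coefC; case: i => [|i]; rewrite ?sub0r ?subr0. Qed.

Lemma mpolyX1_neq0 (n : nat) (R : comNzRingType) (i : 'I_n) :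
  ('X_i : {mpoly R[n]}) != 0.
Proof.
apply/eqP => /(congr1 (meval (fun=> 1))); apply/eqP.
by rewrite mevalXU meval0 oner_neq0.
Qed.

(** * Exchange relations and freely generating clusters *)

Section ExchangeSum.
Variables (n : nat) (B : 'M[int]_n) (k : 'I_n).

(** The right-hand side of an exchange relation, over any ring: it is needed for
polynomials, for elements of the ambient field, and for the values at 1. *)
Definition exchange_sum (R : comNzRingType) (a b : R) (x : 'I_n -> R) : R :=
  a * \prod_(i | 0 < B i k) x i ^+ `|B i k|%N
  + b * \prod_(i | B i k < 0) x i ^+ `|B i k|%N.

Lemma eq_exchange_sum (R : comNzRingType) (a b : R) x y :
  (forall i, B i k != 0 -> x i = y i) ->
  exchange_sum a b x = exchange_sum a b y.
Proof.
move=> xy; congr (_ * _ + _ * _); apply: eq_bigr => i Bik; rewrite xy //.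
  by rewrite gt_eqF.
by rewrite lt_eqF.
Qed.

Lemma exchange_sum1 (R : comNzRingType) (a b : R) x :
  (forall i, x i = 1) -> exchange_sum a b x = a + b.
Proof.
by move=> x1; rewrite /exchange_sum !big1 ?mulr1 // => i _; rewrite x1 expr1n.
Qed.

Lemma rmorph_exchange_sum (R S : comNzRingType) (f : {rmorphism R -> S}) a b x :
  f (exchange_sum a b x) = exchange_sum (f a) (f b) (f \o x).
Proof.
rewrite rmorphD !rmorphM !rmorph_prod.
by congr (_ * _ + _ * _); apply: eq_bigr => i _; rewrite rmorphXn.
Qed.

End ExchangeSum.

Section Ambient.
Variables (P : semifieldType).
Local Notation K := (coefField P).

HB.instance Definition _ n := GRing.RMorphism.copy (@constK P n)
  (@FracField.tofrac {mpoly K[n]} \o @mpolyC n K).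
HB.instance Definition _ n := GRing.RMorphism.copy (@constZP P n)
  (@constK P n \o @FracField.tofrac (groupring P)).

Lemma ambient_gen_ind n (Q : ambient P n -> Prop) :
  (forall c, Q (constK n c)) -> (forall i, Q (ambient_var P i)) ->
  (forall u v, Q u -> Q v -> Q (u + v)) ->
  (forall u v, Q u -> Q v -> Q (u * v)) ->
  (forall u, Q u -> Q u^-1) -> forall u, Q u.
Proof.
move=> QC QX QD QM QV u; have [a [b [_ ->]]] := fractionP u.
have Qf (q : {mpoly K[n]}) : Q (FracField.tofrac q).
  elim/mpoly_ring_ind: q => [c|i|p q|p q]; [exact: QC|exact: QX| |].
  - by rewrite rmorphD; exact: QD.
  - by rewrite rmorphM; exact: QM.
exact: QM (Qf _) (QV _ (Qf _)).
Qed.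

Lemma ambient_rmorph_ext n (L : fieldType) (f g : {rmorphism ambient P n -> L}) :
  (forall c, f (constK n c) = g (constK n c)) ->
  (forall i, f (ambient_var P i) = g (ambient_var P i)) -> f =1 g.
Proof.
move=> fgC fgX; apply: ambient_gen_ind => // [u v|u v|u] Eu => [Ev|Ev|].
- by rewrite !rmorphD Eu Ev.
- by rewrite !rmorphM Eu Ev.
- by rewrite !fmorphV Eu.
Qed.

Definition free_family n m (x : {ffun 'I_n -> ambient P m}) : Prop :=
  forall q, mmap (@constK P m) x q = 0 -> q = 0.

Lemma free_family_subst n m (x : {ffun 'I_n -> ambient P m}) : free_family x ->
  exists f : {rmorphism ambient P n -> ambient P m},
    forall q, f (FracField.tofrac q) = mmap (@constK P m) x q.
Proof.
move=> fx; exists (frac_lift_rmorphism fx) => q; exact: (frac_lift_tofrac fx).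
Qed.

Definition rational_left_inverse n m (y : {ffun 'I_m -> ambient P n})
    (x : {ffun 'I_n -> ambient P m}) : {mpoly K[n]} -> Prop :=
  clears_denominators (@FracField.tofrac {mpoly K[n]})
    (@FracField.tofrac {mpoly K[m]})
    (mmap (@constK P m) x) (mmap (@constK P n) y).

Lemma rational_left_inverse_all n m y x :
  (forall i, @rational_left_inverse n m y x 'X_i) ->
  forall q, rational_left_inverse y x q.
Proof.
move=> HX; elim/mpoly_ring_ind => [c|//|p q|p q].
- by exists (mpolyC m c), 1; rewrite !rmorph1 !mulr1 /= !mmapC !oner_neq0.
- exact: clears_denominatorsD.
- exact: clears_denominatorsM.
Qed.

(** If phi q = 0, then the numerator g of phi q vanishes, hence so does
psi g = q * psi u. This replaces an argument with transcendence degrees. *)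
Lemma rational_left_inverse_free n m y x :
  (forall i, @rational_left_inverse n m y x 'X_i) -> free_family x.
Proof.
move=> HX q q0; have [g [u [u0 yu0]]] := rational_left_inverse_all HX q.
rewrite /= q0 mul0r => /esym/eqP; rewrite tofrac_eq0 => /eqP ->.
rewrite raddf0 => /esym/eqP; rewrite mulf_eq0 (negPf yu0) orbF tofrac_eq0.
by move/eqP.
Qed.

Lemma rational_left_inverse_cancel n m (y : {ffun 'I_m -> ambient P n})
    (x : {ffun 'I_n -> ambient P m})
    (f : {rmorphism ambient P n -> ambient P m})
    (g : {rmorphism ambient P m -> ambient P n}) :
  (forall q, f (FracField.tofrac q) = mmap (@constK P m) x q) ->
  (forall q, g (FracField.tofrac q) = mmap (@constK P n) y q) ->
  (forall i, @rational_left_inverse n m y x 'X_i) -> cancel f g.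
Proof.
move=> fE gE HX; apply: (ambient_rmorph_ext (f := g \o f) (g := idfun)) => [c|i].
  by rewrite /= /constK fE mmapC gE mmapC.
rewrite /= /ambient_var; have [a [u [u0 yu0 E1 E2]]] := HX i.
apply: (mulIf yu0); rewrite /= fE -[in RHS]E2 -!gE -rmorphM E1.
exact: gE.
Qed.

(** The clusters that occur: images of the variables under an isomorphism over the
coefficient field. This is stronger than being a transcendence basis, as it says
that the cluster generates the ambient field, and it is what mutations preserve. *)
Definition free_cluster n m (x : {ffun 'I_n -> ambient P m}) : Prop :=
  exists f : {rmorphism ambient P n -> ambient P m},
    [/\ bijective f, forall c, f (constK n c) = constK m c &
        forall i, f (ambient_var P i) = x i].

Lemma rational_inverse_free_cluster n m y x :
  (forall i, @rational_left_inverse n m y x 'X_i) ->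
  (forall j, @rational_left_inverse m n x y 'X_j) -> free_cluster x.
Proof.
move=> Hx Hy.
have [f fE] := free_family_subst (rational_left_inverse_free Hx).
have [g gE] := free_family_subst (rational_left_inverse_free Hy).
exists f; split=> [|c|i].
- by exists g; [exact: rational_left_inverse_cancel fE gE Hx|
                exact: rational_left_inverse_cancel gE fE Hy].
- by rewrite /= /constK fE mmapC.
- by rewrite /= /ambient_var fE mmapX mmap1U.
Qed.

Lemma free_cluster_rename n m (s : 'I_n -> 'I_m) : bijective s ->
  free_cluster [ffun i => ambient_var P (s i)].
Proof.
move=> [t st ts]; apply: (@rational_inverse_free_cluster n m
  [ffun j => ambient_var P (t j)]) => i.
  exists 'X_(s i), 1; rewrite !rmorph1 !mulr1 /= !mmapX !mmap1U !ffunE st.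
  by rewrite !oner_neq0.
exists 'X_(t i), 1; rewrite !rmorph1 !mulr1 /= !mmapX !mmap1U !ffunE ts.
by rewrite !oner_neq0.
Qed.

Lemma free_cluster_transcendence_basis n (x : {ffun 'I_n -> ambient P n}) :
  free_cluster x -> transcendence_basis x.
Proof.
move=> [f [[g fg gf] fC fX]].
have fE q : evalK x q = f (FracField.tofrac q).
  rewrite /evalK; elim/mpoly_ring_ind: q => [c|i|p q|p q].
  - by rewrite mmapC /= -fC.
  - by rewrite mmapX mmap1U /= -fX.
  - by move=> Ep Eq; rewrite !rmorphD /= Ep Eq.
  - by move=> Ep Eq; rewrite !rmorphM /= Ep Eq.
split=> [q|u].
  rewrite fE => /eqP; rewrite fmorph_eq0 tofrac_eq0; exact: eqP.
have [a [b [b0 E]]] := fractionP (g u).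
exists ('X - u%:P); split; first by rewrite polyXsubC_eq0.
  have gen1 p q : evalK x q != 0 -> generated_subfield x (evalK x p / evalK x q).
    by exists p, q.
  have gen q : generated_subfield x (evalK x q).
    rewrite -[evalK x q]divr1 -(rmorph1 (mmap (@constK P n) x)).
    by apply: gen1; rewrite /evalK rmorph1 oner_neq0.
  move=> i; rewrite coef_XsubC; case: i => [|i].
    exists (- a), b; rewrite !fE fmorph_eq0 tofrac_eq0 b0; split=> //.
    by rewrite -[u in LHS]gf E fmorph_div -mulNr -!rmorphN.
  by have := gen (i.+1 == 1)%:R; rewrite fE !rmorph_nat.
by rewrite root_XsubC.
Qed.

(** The coefficient of p is 1 or 2. *)
Lemma gr_of_sum_neq0 (p q : P) : gr_of p + gr_of q != 0.
Proof.
apply/eqP => /(congr1 (monalg.mcoeff p)).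
rewrite monalg.mcoeffD monalg.mcoeff0 !monalg.mcoeffU eqxx /=.
by case: (q == p).
Qed.

Definition exchange_poly n (B : 'M[int]_n) (k : 'I_n) (p : P * P) : {mpoly K[n]} :=
  exchange_sum B k (mpolyC n (FracField.tofrac (gr_of p.1)))
    (mpolyC n (FracField.tofrac (gr_of p.2))) (fun i => 'X_i).

(** At the point all of whose coordinates are 1 the value is the sum of the two
coefficients, which does not vanish. *)
Lemma exchange_poly_neq0 n (B : 'M[int]_n) k p : exchange_poly B k p != 0.
Proof.
apply/eqP => /(congr1 (meval (fun=> 1))); apply/eqP.
rewrite meval0 rmorph_exchange_sum /= !mevalC exchange_sum1.
  by rewrite -rmorphD tofrac_eq0 gr_of_sum_neq0.
by move=> i; rewrite /= mevalXU.
Qed.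

Definition exchange_rhs n (B : 'M[int]_n) (k : 'I_n) (p : P * P)
    (x : {ffun 'I_n -> ambient P n}) : ambient P n :=
  exchange_sum B k (constP n p.1) (constP n p.2) x.

Lemma mmap_exchange_poly n m (B : 'M[int]_n) k p (x : {ffun 'I_n -> ambient P m}) :
  mmap (@constK P m) x (exchange_poly B k p) =
  exchange_sum B k (constP m p.1) (constP m p.2) x.
Proof.
rewrite [LHS]rmorph_exchange_sum /= !mmapC; apply: eq_exchange_sum => i _.
by rewrite /= mmapX mmap1U.
Qed.

Definition exchanged n (k : 'I_n) (z : ambient P n) : {ffun 'I_n -> ambient P n} :=
  [ffun i => if i == k then z else ambient_var P i].

Lemma ambient_var_neq0 n (i : 'I_n) : ambient_var P i != 0.
Proof. by rewrite tofrac_eq0 mpolyX1_neq0. Qed.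

(** Since M is fixed by the substitution of M / X_k for X_k, that substitution takes
M / X_k to M / (M / X_k) = X_k: it is its own inverse. *)
Lemma free_cluster_involution n (k : 'I_n) (M : {mpoly K[n]}) :
  let x := exchanged k (FracField.tofrac M / ambient_var P k) in
  M != 0 -> mmap (@constK P n) x M = FracField.tofrac M -> free_cluster x.
Proof.
move=> x M0 xM.
have mX j : mmap (@constK P n) x 'X_j = x j by rewrite mmapX mmap1U.
have mX0 j : ('X_j : {mpoly K[n]}) != 0 by exact: mpolyX1_neq0.
have Mf0 : FracField.tofrac M != 0 by rewrite tofrac_eq0.
have xE i : i != k -> x i = ambient_var P i by rewrite ffunE => /negPf ->.
have xk : x k = FracField.tofrac M / ambient_var P k by rewrite ffunE eqxx.
have xk0 : x k != 0.
  by rewrite xk; apply: mulf_neq0 Mf0 _; rewrite invr_eq0; exact: ambient_var_neq0.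
suff self_inverse : forall i, rational_left_inverse x x 'X_i.
  exact: (rational_inverse_free_cluster self_inverse self_inverse).
move=> i.
have [->|ik] := eqVneq i k.
  exists M, 'X_k; split; rewrite /= ?mX ?xM // xk.
    exact: divfK (ambient_var_neq0 k) _.
  by rewrite mulrC; apply/esym/divfK; exact: ambient_var_neq0.
exists 'X_i, 1; split; rewrite /= ?mX ?xE ?rmorph1 ?mulr1 ?oner_neq0 //.
Qed.

Lemma free_cluster_exchange n (B : 'M[int]_n) (k : 'I_n) p : B k k = 0 ->
  free_cluster
    (exchanged k (FracField.tofrac (exchange_poly B k p) / ambient_var P k)).
Proof.
move=> Bkk; apply: free_cluster_involution; first exact: exchange_poly_neq0.
rewrite mmap_exchange_poly rmorph_exchange_sum.
apply: eq_exchange_sum => i Bik; rewrite ffunE ifN //.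
by apply: contra_neq Bik => ->.
Qed.

Lemma free_cluster_neq0 n (x : {ffun 'I_n -> ambient P n}) i :
  free_cluster x -> x i != 0.
Proof.
by move=> [f [_ _ <-]]; rewrite fmorph_eq0 tofrac_eq0 mpolyX1_neq0.
Qed.

Lemma free_cluster_comp n m l (x : {ffun 'I_n -> ambient P m})
    (f : {rmorphism ambient P m -> ambient P l}) :
  bijective f -> (forall c, f (constK m c) = constK l c) ->
  free_cluster x -> free_cluster [ffun i => f (x i)].
Proof.
move=> bf fC [g [bg gC gX]]; exists (f \o g); split; first exact: bij_comp.
  by move=> c; rewrite /= gC fC.
by move=> i; rewrite /= gX ffunE.
Qed.

(** The new cluster is the image of the exchange involution under the automorphism
that defines the old cluster. *)
Lemma free_cluster_mutation n (B : 'M[int]_n) k p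
    (x x' : {ffun 'I_n -> ambient P n}) : B k k = 0 ->
  free_cluster x -> (forall i, i != k -> x' i = x i) ->
  x k * x' k = exchange_rhs B k p x -> free_cluster x'.
Proof.
move=> Bkk fx xE xk; have xk0 := free_cluster_neq0 k fx.
have [f [bf fC fX]] := fx.
suff -> : x' = [ffun i => f (exchanged k
    (FracField.tofrac (exchange_poly B k p) / ambient_var P k) i)].
  exact/free_cluster_comp/free_cluster_exchange.
apply/ffunP => i; rewrite !ffunE; case: eqVneq => [->|ik]; last by rewrite fX xE.
apply: (mulfI xk0); rewrite xk fmorph_div fX mulrC divfK //.
rewrite !rmorph_exchange_sum /=.
have fP q : f (FracField.tofrac (mpolyC n (FracField.tofrac (gr_of q)))) =
    constP n q by exact: fC.
rewrite !fP.
by apply: eq_exchange_sum => j _; rewrite -fX.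
Qed.

Lemma free_cluster_relabel n m (x : {ffun 'I_n -> ambient P m}) l (s : 'I_n -> 'I_l)
    (x' : {ffun 'I_l -> ambient P m}) :
  bijective s -> free_cluster x -> (forall i, x' (s i) = x i) -> free_cluster x'.
Proof.
move=> [t st ts] [f [bf fC fX]] xE.
have tb : bijective t by exists s.
suff -> : x' = [ffun i => f ([ffun i => ambient_var P (t i)] i)].
  by apply: free_cluster_comp => //; exact: free_cluster_rename.
by apply/ffunP => i; rewrite !ffunE fX -xE ts.
Qed.

End Ambient.

(** * Mutations of matrices *)

Definition mutation_term (x y : int) : int :=
  if (0 < x) && (0 < y) then x * y
  else if (x < 0) && (y < 0) then - (x * y) else 0.

Lemma mutation_termE x y : ((`|x| * y + x * `|y|) %/ 2)%Z = mutation_term x y.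
Proof.
have half (z : int) : ((z + z) %/ 2)%Z = z.
  by rewrite (_ : z + z = z * 2) ?mulzK // mulr2n mulrDr mulr1.
rewrite /mutation_term; case: (ltrgt0P x) => x0; case: (ltrgt0P y) => y0;
  rewrite /= ?x0 ?y0 ?mul0r ?mulr0 ?addr0 ?mulrN ?mulNr ?addNr ?subrr ?div0z //.
Qed.

Section MatrixMutation.
Variable n : nat.
Implicit Types (B : 'M[int]_n) (k : 'I_n) (d : 'I_n -> int).

Lemma matrix_mutationE k B i j : matrix_mutation k B i j =
  if (i == k) || (j == k) then - B i j
  else B i j + mutation_term (B i k) (B k j).
Proof. by rewrite mxE mutation_termE. Qed.

Lemma matrix_mutationK k : involutive (@matrix_mutation n k).
Proof.
move=> B; apply/matrixP => i j; rewrite !matrix_mutationE.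
case: eqVneq => [->|ik] /=; first by rewrite opprK.
case: eqVneq => [->|jk] /=; first by rewrite opprK.
rewrite !eqxx /mutation_term /= !oppr_gt0 !oppr_lt0 mulrNN -addrA.
have [x0|x0|x0] := ltrgt0P (B i k); have [y0|y0|y0] := ltrgt0P (B k j);
  by rewrite /= ?addrN ?addNr ?addr0.
Qed.

Definition skew_symmetrized_by d B :=
  (forall i, 0 < d i) /\ forall i j, d i * B i j = - (d j * B j i).

Lemma skew_symmetrized_sign d B i j : skew_symmetrized_by d B ->
  (0 < B i j) = (B j i < 0).
Proof.
move=> [d0 dB]; rewrite -(pmulr_rgt0 _ (d0 i)) dB oppr_gt0.
by rewrite pmulr_rlt0.
Qed.

Lemma skew_symmetrized_sign_skew d B :
  skew_symmetrized_by d B -> sign_skew_symmetric B.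
Proof.
move=> dB i j; have := skew_symmetrized_sign i j dB.
have := skew_symmetrized_sign j i dB.
have [x0|x0|x0] := ltrgt0P (B i j); have [y0|y0|y0] := ltrgt0P (B j i) => //= _ _.
- by right; rewrite pmulr_rlt0.
- by right; rewrite nmulr_rlt0.
- by left.
Qed.

Lemma skew_symmetrized_diag d B i : skew_symmetrized_by d B -> B i i = 0.
Proof.
move=> dB; have := skew_symmetrized_sign i i dB.
by have [x0|x0|x0] := ltrgt0P (B i i).
Qed.

Lemma skew_symmetrized_mutation d B k :
  skew_symmetrized_by d B -> skew_symmetrized_by d (matrix_mutation k B).
Proof.
move=> dB; have [d0 E] := dB; split=> // i j.
rewrite !matrix_mutationE orbC; case: ifP => _; first by rewrite !mulrN E.
rewrite !mulrDr E opprD; congr (_ + _).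
have H : d i * (B i k * B k j) = d j * (B j k * B k i).
  have E1 := E i k; have E2 := E k j.
  by rewrite mulrA E1 mulNr mulrAC E2; ring.
have sg u v := skew_symmetrized_sign u v dB.
rewrite /mutation_term -(sg i k) (sg k i) -(sg k j) (sg j k).
have [x0|x0|x0] := ltrgt0P (B i k); have [y0|y0|y0] := ltrgt0P (B k j);
  by rewrite /= ?mulrN ?H ?mulr0 ?oppr0 ?opprK.
Qed.

End MatrixMutation.

(** * Mutations of coefficients *)

Section CoefficientMutation.
Variables (P : semifieldType) (n : nat).
Implicit Types (B : 'M[int]_n) (k : 'I_n) (p : {ffun 'I_n -> P * P}).

(** A normalized pair is determined by its ratio, and every ratio occurs. So the
tuples of normalized coefficients are arbitrary tuples of ratios, and the rules
for ratios define the mutation of coefficients completely. *)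
Definition normal_pair (r : P) : P * P :=
  ((r / oplus r 1)%g, (oplus r 1)^-1%g).

Lemma normal_pair_ratio r : ((normal_pair r).1 / (normal_pair r).2)%g = r.
Proof. by rewrite /= invgK mulgVK. Qed.

Lemma normal_pair_oplus r : oplus (normal_pair r).1 (normal_pair r).2 = 1%g.
Proof.
rewrite /= semifield_mulC -[X in oplus _ X]mulg1 -mulg_oplusr.
by rewrite mulVg.
Qed.

Lemma normal_pairK (a : P * P) : oplus a.1 a.2 = 1%g ->
  normal_pair (a.1 / a.2)%g = a.
Proof.
case: a => a b /= ab; have E : oplus (a / b)%g 1%g = b^-1%g.
  by rewrite -(mulVg b) semifield_mulC -mulg_oplusr ab mulg1.
by rewrite /normal_pair E invgK mulgVK.
Qed.

Lemma normalizedP p : reflect (forall i, oplus (p i).1 (p i).2 = 1%g) (normalized p).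
Proof. exact: 'forall_eqP. Qed.

Definition ratio_mutation k B p (i : 'I_n) : P :=
  if i == k then ((p k).2 / (p k).1)%g
  else if 0 <= B k i then ((p k).1 ^+ `|B k i|%N * ((p i).1 / (p i).2))%g
  else ((p k).2 ^- `|B k i|%N * ((p i).1 / (p i).2))%g.

Definition coef_mutation k B p : {ffun 'I_n -> P * P} :=
  [ffun i => normal_pair (ratio_mutation k B p i)].

Lemma coef_mutation_normalized k B p : normalized (coef_mutation k B p).
Proof. by apply/normalizedP => i; rewrite ffunE normal_pair_oplus. Qed.

Lemma coef_mutation_unique k B p p' : normalized p' ->
  (forall i, ((p' i).1 / (p' i).2)%g = ratio_mutation k B p i) ->
  p' = coef_mutation k B p.
Proof.
move=> /normalizedP p'n E; apply/ffunP => i.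
by rewrite ffunE -E normal_pairK.
Qed.

Lemma normal_pairV (a : P * P) : oplus a.1 a.2 = 1%g ->
  normal_pair (a.2 / a.1)%g = (a.2, a.1).
Proof. by move=> a1; apply: (normal_pairK (a := (a.2, a.1))); rewrite /= oplusC. Qed.

Lemma coef_mutation_self k B p : normalized p ->
  coef_mutation k B p k = ((p k).2, (p k).1).
Proof.
by move=> /normalizedP pn; rewrite ffunE /ratio_mutation eqxx normal_pairV.
Qed.

Lemma coef_mutationK k B p : normalized p ->
  coef_mutation k (matrix_mutation k B) (coef_mutation k B p) = p.
Proof.
move=> pn; apply/esym/coef_mutation_unique => // i.
rewrite /ratio_mutation coef_mutation_self //=.
have [->//|ik] := eqVneq i k.
rewrite matrix_mutationE eqxx /= abszN oppr_ge0 ffunE normal_pair_ratio.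
rewrite /ratio_mutation (negPf ik).
have [x0|x0|->] := ltrgt0P (B k i); last by rewrite !expg0 !mul1g.
  by rewrite mulgA mulVg mul1g.
by rewrite mulgA mulgV mul1g.
Qed.

Lemma coef_mutation_ratio k B p i : normalized p ->
  ((p i).1 / (p i).2)%g =
  ratio_mutation k (matrix_mutation k B) (coef_mutation k B p) i.
Proof.
by move=> pn; rewrite -{1 2}(coef_mutationK k B pn) ffunE normal_pair_ratio.
Qed.

End CoefficientMutation.

(** * Mutation classes of seeds *)

Section SeedMutation.
Variables (P : semifieldType) (n : nat).
Implicit Types (S : seed P n) (k : 'I_n).

(** An inductive strengthening of [is_seed]: sign-skew-symmetry alone is not stable
under mutations, skew-symmetrizability is. *)
Definition free_seed S : Prop :=
  [/\ free_cluster (cluster S), normalized (coefs S) &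
      exists d, skew_symmetrized_by d (exchange_matrix S)].

Lemma free_seed_is_seed S : free_seed S -> is_seed S.
Proof.
move=> [fx pn [d dB]]; split=> //.
  exact: free_cluster_transcendence_basis.
exact: skew_symmetrized_sign_skew dB.
Qed.

Lemma mutationP k S S' : mutation k S S' <->
  [/\ forall i, i != k -> cluster S' i = cluster S i,
      cluster S k * cluster S' k =
        exchange_rhs (exchange_matrix S) k (coefs S k) (cluster S),
      normalized (coefs S'),
      forall i, ((coefs S' i).1 / (coefs S' i).2)%g =
        ratio_mutation k (exchange_matrix S) (coefs S) i &
      exchange_matrix S' = matrix_mutation k (exchange_matrix S)].
Proof. by case: S => x p B; case: S' => x' p' B'. Qed.

Definition mutate k S : seed P n := Seed
  [ffun i => if i == k
     then exchange_rhs (exchange_matrix S) k (coefs S k) (cluster S) / cluster S k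
     else cluster S i]
  (coef_mutation k (exchange_matrix S) (coefs S))
  (matrix_mutation k (exchange_matrix S)).

Lemma mutation_mutate k S : free_seed S -> mutation k S (mutate k S).
Proof.
move=> [fx pn _]; apply/mutationP; split=> //=.
- by move=> i ik; rewrite ffunE (negPf ik).
- rewrite ffunE eqxx mulrC; apply: divfK; exact: free_cluster_neq0.
- exact: coef_mutation_normalized.
- by move=> i; rewrite ffunE normal_pair_ratio.
Qed.

Lemma free_seed_mutation k S S' : free_seed S -> mutation k S S' -> free_seed S'.
Proof.
move=> [fx pn [d dB]] /mutationP [xE xk p'n _ BE]; split=> //.
  exact: free_cluster_mutation (skew_symmetrized_diag k dB) fx xE xk.
by exists d; rewrite BE; exact: skew_symmetrized_mutation.
Qed.

Lemma mutation_sym k S S' : free_seed S -> mutation k S S' -> mutation k S' S.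
Proof.
move=> [fx pn [d dB]] /mutationP [xE xk p'n rE BE].
have pE := coef_mutation_unique p'n rE.
apply/mutationP; split=> //.
- by move=> i /xE.
- rewrite mulrC xk BE pE coef_mutation_self // /exchange_rhs /exchange_sum /=.
  rewrite [RHS]addrC.
  have BN i : matrix_mutation k (exchange_matrix S) i k = - exchange_matrix S i k.
    by rewrite matrix_mutationE eqxx orbT.
  have Bkk := skew_symmetrized_diag k dB.
  congr (_ * _ + _ * _).
    apply: eq_big => i; first by rewrite BN oppr_lt0.
    move=> Bi; rewrite BN abszN xE //.
    by apply: contraTneq Bi => ->; rewrite Bkk ltxx.
  apply: eq_big => i; first by rewrite BN oppr_gt0.
  move=> Bi; rewrite BN abszN xE //.
  by apply: contraTneq Bi => ->; rewrite Bkk ltxx.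
- by move=> i; rewrite BE pE; exact: coef_mutation_ratio.
- by rewrite BE matrix_mutationK.
Qed.

Definition relabel_seed (t : 'I_n -> 'I_n) S : seed P n := Seed
  [ffun i => cluster S (t i)] [ffun i => coefs S (t i)]
  (\matrix_(i, j) exchange_matrix S (t i) (t j)).

Lemma relabelingP S S' : relabeling S S' <->
  exists s t, [/\ cancel s t, cancel t s & S' = relabel_seed t S].
Proof.
split=> [[s [t st ts] [xE pE BE]]|[s [t [st ts ->]]]].
  exists s, t; split=> //; case: S' xE pE BE => x' p' B' /= xE pE BE.
  congr Seed; [apply/ffunP|apply/ffunP|apply/matrixP] => i.
  - by rewrite ffunE -xE ts.
  - by rewrite ffunE -pE ts.
  - by move=> j; rewrite mxE -BE !ts.
exists s; first by exists t.
by split=> [i|i|i j]; rewrite ?ffunE ?mxE /= ?ffunE ?mxE ?st.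
Qed.

Lemma relabeling_refl S : relabeling S S.
Proof. by exists id; [exists id|]. Qed.

Lemma relabeling_sym S S' : relabeling S S' -> relabeling S' S.
Proof.
move=> [s [t st ts] [xE pE BE]]; exists t; first by exists s.
by split=> [i|i|i j]; rewrite -?xE -?pE -?BE !ts.
Qed.

Lemma relabeling_trans S1 S2 S3 :
  relabeling S1 S2 -> relabeling S2 S3 -> relabeling S1 S3.
Proof.
move=> [s sb [xE pE BE]] [s' sb' [xE' pE' BE']]; exists (s' \o s).
  exact: bij_comp.
by split=> [i|i|i j] /=; rewrite ?xE' ?xE ?pE' ?pE ?BE' ?BE.
Qed.

Lemma free_seed_relabel S S' : free_seed S -> relabeling S S' -> free_seed S'.
Proof.
move=> [fx /normalizedP pn [d [d0 dB]]] /relabelingP[s [t [st ts ->]]].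
split=> /=.
- apply: (free_cluster_relabel (s := s)) fx _; first by exists t.
  by move=> i; rewrite ffunE st.
- by apply/normalizedP => i; rewrite ffunE pn.
- exists (fun i => d (t i)); split=> [i|i j]; first exact: d0.
  by rewrite !mxE; exact: dB.
Qed.

Lemma mutation_relabel k s t S S' : cancel s t -> cancel t s ->
  mutation k S S' -> mutation (s k) (relabel_seed t S) (relabel_seed t S').
Proof.
move=> st ts /mutationP [xE xk p'n rE BE].
have stE i : (i == s k) = (t i == k).
  by apply/eqP/eqP => [->|<-]; rewrite ?st ?ts.
have sb : bijective s by exists t.
apply/mutationP; split=> /=.
- by move=> i; rewrite stE !ffunE => /xE.
- rewrite !ffunE st xk /exchange_rhs /exchange_sum.
  congr (_ * _ + _ * _); rewrite (reindex t) /=.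
  + by apply: eq_big => i; rewrite mxE st // ffunE.
  + by exists s => i _; rewrite ?st ?ts.
  + by apply: eq_big => i; rewrite mxE st // ffunE.
  + by exists s => i _; rewrite ?st ?ts.
- by move/normalizedP: p'n => p'n; apply/normalizedP => i; rewrite ffunE.
- by move=> i; rewrite ffunE rE /ratio_mutation stE !ffunE !mxE st.
- apply/matrixP => i j; rewrite matrix_mutationE !mxE BE matrix_mutationE.
  by rewrite !stE !st.
Qed.

Lemma mutation_related_refl S : mutation_related S S.
Proof. exact/mutation_related_relabel/relabeling_refl. Qed.

Lemma mutation_related_mutation S S' S'' k :
  free_seed S' -> mutation_related S S' -> mutation k S' S'' ->
  mutation_related S S''.
Proof.
move=> gS' SS' S'S''; apply: (mutation_related_step SS' _ S'S'').
exact: free_seed_is_seed (free_seed_mutation gS' S'S'').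
Qed.

Lemma free_seed_related S S' : free_seed S -> mutation_related S S' -> free_seed S'.
Proof.
move=> gS; elim=> [S1|S1 S2 k _ gS1 _]; first exact: free_seed_relabel.
exact: free_seed_mutation.
Qed.

(** Relabeling commutes with mutation, so it can be moved to the beginning of a
sequence of mutations, the only place where [mutation_related] allows it. *)
Lemma mutation_related_relabeling S S' S'' : free_seed S ->
  mutation_related S S' -> relabeling S' S'' -> mutation_related S S''.
Proof.
move=> gS SS'; elim: SS' S'' => [S1 SS1 S2 S1S2|S1 S2 k SS1 IH _ S1S2 S3].
  exact/mutation_related_relabel/(relabeling_trans SS1).
move=> /relabelingP [s [t [st ts ->]]].
have gS1 := free_seed_related gS SS1.
have R : relabeling S1 (relabel_seed t S1) by apply/relabelingP; exists s, t.
apply: (@mutation_related_mutation _ (relabel_seed t S1) _ (s k)).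
- exact: free_seed_relabel gS1 R.
- exact: IH.
- exact: mutation_relabel.
Qed.

Lemma mutation_related_trans S S' S'' : free_seed S ->
  mutation_related S S' -> mutation_related S' S'' -> mutation_related S S''.
Proof.
move=> gS SS'; have gS' := free_seed_related gS SS'.
elim=> [S1|S1 S2 k S'S1 SS1 _ S1S2]; first exact: mutation_related_relabeling.
exact: mutation_related_mutation (free_seed_related gS' S'S1) SS1 S1S2.
Qed.

Lemma mutation_related_sym S S' : free_seed S ->
  mutation_related S S' -> mutation_related S' S.
Proof.
move=> gS; elim=> [S1 SS1|S1 S2 k SS1 S1S _ S1S2].
  exact/mutation_related_relabel/relabeling_sym.
have gS1 := free_seed_related gS SS1; have gS2 := free_seed_mutation gS1 S1S2.
apply: (mutation_related_trans gS2 _ S1S).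
apply: mutation_related_mutation gS2 (mutation_related_refl _) _.
exact: (mutation_sym gS1 S1S2).
Qed.

Definition mutation_class S0 (gS0 : free_seed S0) : seed_class P n.
Proof.
refine (@SeedClass P n (mutation_related S0) _ _ _ _).
- by move=> S /(free_seed_related gS0) /free_seed_is_seed.
- by move=> S S'; exact: mutation_related_relabeling.
- move=> S k S0S; have gS := free_seed_related gS0 S0S.
  exists (mutate k S); first exact: mutation_mutate.
  exact: mutation_related_mutation gS S0S (mutation_mutate k gS).
- move=> S S' S0S S0S'; apply: (mutation_related_trans _ _ S0S').
    exact: free_seed_related S0S.
  exact: mutation_related_sym.
Defined.

Lemma free_initial_seed (B : 'M[int]_n) p d :
  normalized p -> skew_symmetrized_by d B -> free_seed (initial_seed B p).
Proof.
move=> pn dB; split=> //=; last by exists d.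
by apply: (@free_cluster_rename P n n id); exists id.
Qed.

End SeedMutation.

(** * Transport of series along mutations *)

Section CoefficientTransfer.
Variables (P : semifieldType) (n : nat).

Local Notation coefficients := {p : {ffun 'I_n -> P * P} | normalized p}.

(** What makes the series of B and B' correspond: one bijection of the coefficients
that is realized by mutations of any seed with matrix B. *)
Definition coefficient_transfer (B B' : 'M[int]_n) : Prop :=
  exists2 phi : coefficients -> coefficients, bijective phi &
    forall S p, free_seed S -> exchange_matrix S = B -> coefs S = val p ->
    exists S', [/\ mutation_related S S', exchange_matrix S' = B' &
                   coefs S' = val (phi p)].

Lemma coefficient_transfer_refl B : coefficient_transfer B B.
Proof.
exists id; first by exists id.
by move=> S p gS SB Sp; exists S; split=> //; exact: mutation_related_refl.
Qed.

Lemma coefficient_transfer_trans B1 B2 B3 :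
  coefficient_transfer B1 B2 -> coefficient_transfer B2 B3 ->
  coefficient_transfer B1 B3.
Proof.
move=> [f bf fP] [g bg gP]; exists (g \o f); first exact: bij_comp.
move=> S p gS SB Sp; have [S' [SS' S'B S'p]] := fP S p gS SB Sp.
have [S'' [S'S'' S''B S''p]] := gP S' (f p) (free_seed_related gS SS') S'B S'p.
by exists S''; split=> //; exact: mutation_related_trans SS' S'S''.
Qed.

Lemma coefficient_transfer_mutation B k :
  coefficient_transfer B (matrix_mutation k B).
Proof.
pose phi B0 (p : coefficients) : coefficients :=
  exist _ (coef_mutation k B0 (val p)) (coef_mutation_normalized k B0 (val p)).
exists (phi B).
  exists (phi (matrix_mutation k B)) => p; apply: val_inj => /=.
    by rewrite coef_mutationK //; exact: valP.
  by rewrite -{1}(matrix_mutationK k B) coef_mutationK //; exact: valP.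
move=> S p gS SB Sp; exists (mutate k S); split; rewrite /= ?SB ?Sp //.
exact: mutation_related_mutation gS (mutation_related_refl S) (mutation_mutate k gS).
Qed.
End CoefficientTransfer.

Lemma rmorph_inverse (R S : pzRingType) (f : {rmorphism R -> S}) : bijective f ->
  exists g : {rmorphism S -> R}, cancel f g /\ cancel g f.
Proof.
move=> [g fg gf].
pose gA := GRing.isZmodMorphism.Build S R g (can2_zmod_morphism fg gf).
pose gM := GRing.isMonoidMorphism.Build S R g (can2_monoid_morphism fg gf).
pose h : {rmorphism S -> R} := HB.pack g gA gM.
by exists h.
Qed.

(** In the cluster algebra of B, the seed with matrix C that the transfer provides has
a freely generating cluster. Mapping this cluster to the variables, relabeled by s,
is an isomorphism of the ambient fields that carries the seed to the initial seed of
the cluster algebra of B'. *)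
Lemma series_strongly_isomorphic_of_transfer (P : semifieldType) (n n' : nat)
    (B C : 'M[int]_n) (B' : 'M[int]_n') d d' (s : 'I_n -> 'I_n') :
  bijective s -> (forall i j, C i j = B' (s i) (s j)) ->
  skew_symmetrized_by d B -> skew_symmetrized_by d' B' ->
  coefficient_transfer P B C -> series_strongly_isomorphic P B B'.
Proof.
move=> sb CE dB dB' [phi phib phiP]; have [t st ts] := sb.
have relabel_normalized m m' (r : 'I_m' -> 'I_m)
    (p : {p : {ffun 'I_m -> P * P} | normalized p}) :
    normalized [ffun i => val p (r i)].
  by apply/normalizedP => i; rewrite ffunE; have /normalizedP := valP p.
pose psi m m' (r : 'I_m' -> 'I_m) p :
    {p : {ffun 'I_m' -> P * P} | normalized p} :=
  exist (fun q => is_true (normalized q)) _ (relabel_normalized m m' r p).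
exists (psi n n' t \o phi).
  apply: bij_comp phib; exists (psi n' n s) => p; apply: val_inj => /=.
    by apply/ffunP => i; rewrite !ffunE st.
  by apply/ffunP => i; rewrite !ffunE ts.
move=> p; have g0 := free_initial_seed (valP p) dB.
have g0' := free_initial_seed (valP (psi n n' t (phi p))) dB'.
have [S [S0S SB Sp]] := phiP _ p g0 erefl erefl.
exists (mutation_class g0), (mutation_class g0').
split; [exact: mutation_related_refl|exact: mutation_related_refl|].
have [[h [hb hC hX]] _ _] := free_seed_related g0 S0S.
have [g [hg gh]] := rmorph_inverse hb.
have [r [rb rC rX]] := free_cluster_rename P sb.
exists (r \o g); split.
- by apply: bij_comp => //; exists h.
- by move=> c; rewrite /= /constZP -hC hg rC.
exists S, (initial_seed B' (val (psi n n' t (phi p)))).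
split; [by []|exact: mutation_related_refl|].
exists s => //; split=> /= [i|i|i j].
- by rewrite -hX hg rX !ffunE.
- by rewrite ffunE st Sp.
- by rewrite SB CE.
Qed.

(** * Diagrams of finite type are forests *)

Definition positive_definite (n : nat) (M : 'M[int]_n) : Prop :=
  forall v : 'cV[int]_n, v != 0 -> 0 < (v^T *m M *m v) 0 0.

Definition symmetrized (n : nat) (d : 'rV[int]_n) (A : 'M[int]_n) : 'M[int]_n :=
  diag_mx d *m A.

Lemma symmetrizedE n (d : 'rV[int]_n) A i j :
  symmetrized d A i j = d 0 i * A i j.
Proof.
rewrite mxE (bigD1 i) //= big1 => [|l li]; last by rewrite mxE eq_sym (negPf li) mul0r.
by rewrite mxE eqxx mulr1n addr0.
Qed.

Lemma finite_type_positive_definite n (A : 'M[int]_n) : finite_type A ->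
  exists d : 'rV[int]_n, [/\ forall i, 0 < d 0 i,
    forall i j, d 0 i * A i j = d 0 j * A j i &
    positive_definite (symmetrized d A)].
Proof.
move=> [_ [d [d0 dA pos]]]; exists d; split=> //.
  by move=> i j; have /matrixP/(_ i j) := dA; rewrite mxE !symmetrizedE.
move=> v v0.
have := pos (map_mx intr v); rewrite map_trmx -!map_mxM mxE ltr0z; apply.
apply: contra_neq v0 => /matrixP E; apply/matrixP => i j.
by have /eqP := E i j; rewrite !mxE intr_eq0 => /eqP.
Qed.

Definition leaf n (A : 'M[int]_n) (J : {set 'I_n}) (i : 'I_n) : Prop :=
  forall j1 j2, j1 \in J -> j2 \in J -> j1 != i -> j2 != i ->
    A i j1 != 0 -> A i j2 != 0 -> j1 = j2.

(** For the indicator vector of J the form is a positive combination of the sums of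
the entries of A over J in the rows of J. So one of these sums is positive, and as
it is 2 minus positive integers, one for each neighbour, there is at most one
neighbour. *)
Lemma leaf_exists n (d : 'rV[int]_n) (A : 'M[int]_n) (J : {set 'I_n}) :
  (forall i, 0 < d 0 i) -> positive_definite (symmetrized d A) ->
  (forall i, A i i = 2) -> (forall i j, i != j -> A i j <= 0) ->
  J != set0 -> exists2 i, i \in J & leaf A J i.
Proof.
move=> d0 pos Aii Aij J0.
pose v : 'cV[int]_n := \col_i (i \in J)%:R.
have v0 : v != 0.
  have [i iJ] := set0Pn _ J0; apply/eqP => /matrixP/(_ i 0).
  by rewrite !mxE iJ.
have := pos v v0.
have -> : (v^T *m symmetrized d A *m v) 0 0 =
    \sum_(i in J) d 0 i * \sum_(j in J) A i j.
  rewrite mxE (eq_bigr (fun j => \sum_(i in J) d 0 i * (if j \in J then A i j else 0))).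
    rewrite exchange_big /=; apply: eq_bigr => i _.
    by rewrite -big_distrr /= -big_mkcond.
  move=> j _; rewrite mxE [v j 0]mxE big_distrl /= [RHS]big_mkcond /=.
  apply: eq_bigr => i _; rewrite symmetrizedE !mxE.
  by case: (i \in J); case: (j \in J); rewrite ?mul0r ?mul1r ?mulr0 ?mulr1.
move=> sum_gt0.
have [i iJ rowi] : exists2 i, i \in J & 0 < \sum_(j in J) A i j.
  case: (boolP [exists i in J, 0 < \sum_(j in J) A i j]) => [/exists_inP //|].
  rewrite negb_exists_in => /forall_inP H; move: sum_gt0; rewrite ltNge.
  case/negP; apply: sumr_le0 => i iJ; rewrite pmulr_rle0 //.
  by rewrite leNgt; exact: H.
exists i => // j1 j2 j1J j2J j1i j2i A1 A2; apply/eqP/negPn/negP => j12.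
have lt0 j : j != i -> A i j != 0 -> A i j <= -1.
  by move=> ji Aj; have := Aij i j; rewrite eq_sym => /(_ ji); lia.
move: rowi; rewrite (bigD1 i) //= Aii (bigD1 j1) /=; last by rewrite j1J.
rewrite (bigD1 j2) /=; last by rewrite j2J j2i eq_sym.
have := lt0 _ j1i A1; have := lt0 _ j2i A2.
have : \sum_(j | (j \in J) && (j != i) && (j != j1) && (j != j2)) A i j <= 0.
  apply: sumr_le0 => j /andP[/andP[/andP[_ ji] _] _].
  by apply: Aij; rewrite eq_sym.
by move: (\sum_(j | _) _); lia.
Qed.

(** * Orientations of a forest *)

Section Orientations.
Variables (n : nat) (A : 'M[int]_n).
Implicit Types (B C : 'M[int]_n) (J : {set 'I_n}) (i j k : 'I_n).

(** If the diagonal entries of A are 2, these are the sign-skew-symmetric matrices with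
Cartan counterpart A. *)
Definition orientation B : Prop :=
  (forall i j, (0 < B i j) = (B j i < 0)) /\
  forall i j, i != j -> `|B i j| = - A i j.

Definition flip k B : 'M[int]_n :=
  \matrix_(i, j) if (i == k) || (j == k) then - B i j else B i j.

(** The vertex k is a sink or a source of the diagram that B induces on J. *)
Definition extremal J k B : Prop :=
  (forall j, j \in J -> 0 <= B j k) \/ (forall j, j \in J -> B j k <= 0).

Definition agree J B C : Prop := {in J &, forall i j, B i j = C i j}.

(** Only the diagram induced on J matters for the condition, but the whole matrix is
changed. This allows the induction on J to continue with the same matrix. *)
Inductive flips J B : 'M[int]_n -> Prop :=
  | flips_refl : flips J B B
  | flips_step C k : flips J B C -> k \in J -> extremal J k C ->
      flips J B (flip k C).

Lemma orientation_flip k B : orientation B -> orientation (flip k B).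
Proof.
move=> [sB aB]; split=> [i j|i j ij]; rewrite !mxE.
  by rewrite orbC; case: ifP => _ //; rewrite oppr_gt0 oppr_lt0 -sB.
by case: ifP => _; rewrite ?normrN aB.
Qed.

Lemma orientation_diag B i : orientation B -> B i i = 0.
Proof.
by move=> [sB _]; have := sB i i; have [x0|x0|] := ltrgt0P (B i i).
Qed.

Lemma orientation_flips J B C : orientation B -> flips J B C -> orientation C.
Proof. by move=> oB; elim=> // C' k _ oC _ _; exact: orientation_flip. Qed.

Lemma extremal_leaf J i B : orientation B -> leaf A J i -> extremal J i B.
Proof.
move=> oB lf; have [sB aB] := oB.
case: (boolP [exists j in J, 0 < B j i]) => [/exists_inP [j jJ Bji]|].
  left=> j' j'J; have [->|j'i] := eqVneq j' i; first by rewrite orientation_diag.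
  have ji : j != i by apply: contraTneq Bji => ->; rewrite orientation_diag.
  have [->|jj'] := eqVneq j' j; first exact: ltW.
  have Aij : A i j != 0.
    have := aB i j; rewrite eq_sym => /(_ ji); have := sB j i; lia.
  case: (eqVneq (A i j') 0) => [A0|A0].
    have := aB i j'; rewrite eq_sym A0 => /(_ j'i).
    have := sB j' i; have := sB i j'; lia.
  by rewrite (lf j' j) ?eqxx // in jj'.
rewrite negb_exists_in => /forall_inP H; right=> j jJ.
by rewrite leNgt; exact: H.
Qed.

(** A sink or source k of J without the leaf i need not be one of J, because of the
edge between i and k. If it is not, reverse that edge first by flipping the leaf,
which is always a sink or a source and does not affect the rest of J. *)
Lemma flips_lift J i B B1 C : i \in J -> leaf A J i ->
  flips (J :\ i) B B1 -> orientation C -> agree (J :\ i) B C ->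
  exists C1, flips J C C1 /\ agree (J :\ i) B1 C1.
Proof.
move=> iJ lf; elim=> [|B2 k _ IH] => [oC BC|kJ ext oC BC].
  by exists C; split=> //; exact: flips_refl.
have [C2 [CC2 B2C2]] := IH oC BC; have oC2 := orientation_flips oC CC2.
have [ki kJ'] : k != i /\ k \in J by move: kJ; rewrite in_setD1 => /andP[].
have agree_flip : forall D, agree (J :\ i) B2 D ->
    agree (J :\ i) (flip k B2) (flip k D).
  by move=> D BD a b aJ bJ; rewrite !mxE BD.
(* C3 is C2, or C2 flipped at the leaf, depending on the edge from i to k. *)
have [C3 [CC3 B2C3 ext3]] : exists C3,
    [/\ flips J C C3, agree (J :\ i) B2 C3 & extremal J k C3].
  have fl : flips J C (flip i C2).
    by apply: flips_step => //; exact: extremal_leaf.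
  have ag : agree (J :\ i) B2 (flip i C2).
    move=> a b aJ bJ; rewrite mxE B2C2 //.
    by move: aJ bJ; rewrite !in_setD1 => /andP[/negPf -> _] /andP[/negPf -> _].
  have eqJ D j : agree (J :\ i) B2 D -> j \in J -> j != i -> D j k = B2 j k.
    by move=> BD jJ ji; rewrite -BD // in_setD1 ji.
  have extE D : agree (J :\ i) B2 D ->
      ((forall j, j \in J :\ i -> 0 <= B2 j k) /\ 0 <= D i k) \/
      ((forall j, j \in J :\ i -> B2 j k <= 0) /\ D i k <= 0) -> extremal J k D.
    move=> BD [] [H Hi]; [left|right] => j jJ;
      (have [->//|ji] := eqVneq j i; rewrite eqJ // H // in_setD1 ji //).
  have flE : flip i C2 i k = - C2 i k by rewrite mxE eqxx.
  case: ext => ext; case: (lerP 0 (C2 i k)) => s.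
  - by exists C2; split=> //; apply: extE => //; left.
  - exists (flip i C2); split=> //; apply: extE => //; left; split=> //.
    by rewrite flE oppr_ge0 ltW.
  - exists (flip i C2); split=> //; apply: extE => //; right; split=> //.
    by rewrite flE oppr_le0.
  - by exists C2; split=> //; apply: extE => //; right; split=> //; exact: ltW.
by exists (flip k C3); split; [exact: flips_step|exact: agree_flip].
Qed.

Hypothesis leafA : forall J, J != set0 -> exists2 i, i \in J & leaf A J i.

(** By [flips_lift], a sequence that works without a leaf extends to J. It can be
wrong only at the edge of the leaf, which one more flip at the leaf repairs. *)
Lemma flips_connect J B C : orientation B -> orientation C ->
  exists B1, flips J B B1 /\ agree J B1 C.
Proof.
have [m] := ubnP #|J|; elim: m J => // m IH J Jm oB oC.
have [->|J0] := eqVneq J set0.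
  by exists B; split=> [|a b]; [exact: flips_refl|rewrite in_set0].
have [i iJ lf] := leafA J0.
have [|B1 [BB1 B1C]] := IH (J :\ i) _ oB oC.
  by move: Jm; rewrite (cardsD1 i) iJ.
have [//|B2 [BB2 B12]] := flips_lift iJ lf BB1 oB.
have oB2 := orientation_flips oB BB2.
have [sB aB] := oB2; have [sC aC] := oC.
have swap D : orientation D -> (forall j, j \in J -> D i j = C i j) ->
    agree (J :\ i) D C -> agree J D C.
  move=> [sD aD] Di DC a b aJ bJ.
  have [->|ai] := eqVneq a i; first exact: Di.
  have [->|bi] := eqVneq b i.
    have := Di a aJ; have := aD a i ai; have := aC a i ai.
    have := sD a i; have := sD i a; have := sC a i; have := sC i a; lia.
  by apply: DC; rewrite in_setD1 ?ai ?bi.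
have B2C : agree (J :\ i) B2 C by move=> a b aJ bJ; rewrite -B12 // B1C.
case: (boolP [forall j in J, B2 i j == C i j]) => [/forall_inP H|].
  by exists B2; split=> //; apply: swap => // j jJ; exact/eqP/H.
rewrite negb_forall_in => /exists_inP [j0 j0J neq].
exists (flip i B2); split.
  by apply: flips_step => //; exact: extremal_leaf.
apply: swap; first exact: orientation_flip.
  have j0i : j0 != i.
    by apply: contraNneq neq => ->; rewrite !orientation_diag.
  have A0 : A i j0 != 0.
    move: (aB i j0) (aC i j0) neq; rewrite eq_sym => /(_ j0i) + /(_ j0i).
    lia.
  move=> j jJ; rewrite mxE eqxx /=.
  have [->|ji] := eqVneq j i; first by rewrite !orientation_diag ?oppr0.
  move: (aB i j) (aC i j); rewrite eq_sym => /(_ ji) + /(_ ji).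
  have [->|jj0] := eqVneq j j0; first by move: neq; lia.
  have [->|Aj] := eqVneq (A i j) 0; first by lia.
  by rewrite (lf j j0) ?eqxx // in jj0.
move=> a b aJ bJ; rewrite mxE B2C //.
by move: aJ bJ; rewrite !in_setD1 => /andP[/negPf -> _] /andP[/negPf -> _].
Qed.

(** At a sink or a source there is no path of length 2 through k, so the mutation adds
nothing to the other entries. *)
Lemma flip_mutation k B : orientation B -> extremal [set: 'I_n] k B ->
  flip k B = matrix_mutation k B.
Proof.
move=> [sB _] ext; apply/matrixP => i j; rewrite matrix_mutationE mxE.
case: ifP => // _; rewrite /mutation_term (sB k j) -(sB j k).
have := ext; case=> E; have := E i (in_setT _); have := E j (in_setT _).
  by rewrite !ltNge => -> ->; rewrite ?andbF /= addr0.
by rewrite !ltNge => -> ->; rewrite ?andbF /= addr0.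
Qed.

Lemma coefficient_transfer_orientations (P : semifieldType) B C :
  orientation B -> orientation C -> coefficient_transfer P B C.
Proof.
move=> oB oC; have [B1 [BB1 B1C]] := flips_connect [set: 'I_n] oB oC.
have -> : C = B1 by apply/matrixP => i j; rewrite B1C.
elim: BB1 {B1C} => [|D k BD IH _ ext]; first exact: coefficient_transfer_refl.
apply: (coefficient_transfer_trans IH); rewrite flip_mutation //.
  exact: coefficient_transfer_mutation.
exact: orientation_flips BD.
Qed.

Hypothesis A0sym : forall i j, A i j = 0 -> A j i = 0.

Definition signed_companion (G : 'M[int]_n) : Prop :=
  (forall i, G i i = A i i) /\
  forall i j, i != j -> `|G i j| = - A i j /\ (0 < G i j) = (0 < G j i).

(** The product of the signs of the ends of an edge can be prescribed: in a forest
this is done leaf by leaf. *)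
Lemma signs_exist (G : 'M[int]_n) J : signed_companion G ->
  exists e : 'I_n -> int, (forall i, e i = 1 \/ e i = -1) /\
    {in J &, forall i j, e i * e j * G i j = A i j}.
Proof.
move=> [Gii Gij]; have [m] := ubnP #|J|; elim: m J => // m IH J Jm.
have [->|J0] := eqVneq J set0.
  by exists (fun=> 1); split=> [i|a b]; [left|rewrite in_set0].
have [i iJ lf] := leafA J0.
have [|e [e1 eG]] := IH (J :\ i).
  by move: Jm; rewrite (cardsD1 i) iJ.
have ee l : e l * e l = 1 by case: (e1 l) => ->.
have [c c1 cG] : exists2 c : int, c = 1 \/ c = -1 &
    forall j, j \in J -> j != i ->
      c * e j * G i j = A i j /\ e j * c * G j i = A j i.
  case: (boolP [exists j in J, (j != i) && (A i j != 0)]); last first.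
    rewrite negb_exists_in => /forall_inP H; exists 1; first by left.
    move=> j jJ ji; move: (H j jJ); rewrite ji /= negbK => /eqP A0.
    have ij : i != j by rewrite eq_sym.
    have A0' := A0sym A0; move: (Gij i j ij) (Gij j i ji) => -[a b] [c d].
    have -> : G i j = 0 by lia.
    have -> : G j i = 0 by lia.
    by rewrite !mulr0 A0 A0'.
  move=> /exists_inP [j0 j0J /andP[j0i A0]].
  (* The sign of the leaf makes its only edge in J nonpositive. *)
  exists (if e j0 * G i j0 < 0 then 1 else -1); first by case: ifP; [left|right].
  move=> j jJ ji; have ij : i != j by rewrite eq_sym.
  have [a b] := Gij i j ij; have [c d] := Gij j i ji.
  have [->|jj0] := eqVneq j j0.
    have ij0 : i != j0 by rewrite eq_sym.
    have [a' b'] := Gij i j0 ij0; have [c' d'] := Gij j0 i j0i.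
    case: (e1 j0) => ->; rewrite ?mulN1r ?mul1r; case: ifP => s;
      rewrite ?(mulN1r, mul1r, mulr1, mulrN1, mulNr, opprK);
      split; lia.
  have [Aj|Aj] := eqVneq (A i j) 0; last by case/eqP: jj0; exact: lf.
  have Aj' := A0sym Aj.
  have -> : G i j = 0 by lia.
  have -> : G j i = 0 by lia.
  by rewrite !mulr0 Aj Aj'.
exists (fun l => if l == i then c else e l); split=> [l|a b aJ bJ].
  by case: ifP.
have [->|ai] := eqVneq a i; have [->|bi] := eqVneq b i.
- by case: c1 => ->; rewrite ?mulrNN mulr1 mul1r Gii.
- by have [] := cG b bJ bi.
- by have [] := cG a aJ ai.
- by apply: eG; rewrite in_setD1 ?ai ?bi.
Qed.

End Orientations.

(** * Roots of positive definite lattices *)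

Section Lattice.
Variable n : nat.
Implicit Types (d e f : 'rV[int]_n) (A B E G M : 'M[int]_n) (x y v : 'cV[int]_n).

(** Let the columns of E be vectors of norm 2 e_j, written in a basis of vectors of
norm 2 d_i. The entries of E are integers; the condition says that the coroots of
the columns have integral coordinates in the coroots of the basis as well. *)
Definition dual_integral d e E : Prop :=
  forall i j, (e 0%R j %| d 0%R i * E i j)%Z.

Lemma dual_integral_mul d e f E E2 :
  dual_integral d e E -> dual_integral e f E2 -> dual_integral d f (E *m E2).
Proof.
move=> dE eE i j; rewrite mxE mulr_sumr; apply: rpred_sum => l _.
have /dvdzP [q Eq] := dE i l; rewrite mulrA Eq -mulrA.
by apply: dvdz_mull; exact: eE.
Qed.

Lemma dual_integral1 d : dual_integral d d 1%:M.
Proof.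
move=> i j; rewrite mxE; case: eqVneq => [->|_]; last by rewrite mulr0 dvdz0.
by rewrite mulr1 dvdzz.
Qed.

Definition bform M x y : int := (x^T *m M *m y) 0 0.

Lemma bformE M x y : bform M x y = \sum_i \sum_j x i 0 * M i j * y j 0.
Proof.
rewrite /bform mxE exchange_big /=; apply: eq_bigr => j _.
by rewrite mxE mulr_suml; apply: eq_bigr => i _; rewrite mxE.
Qed.

Lemma bformDl M x y z : bform M (x + y) z = bform M x z + bform M y z.
Proof. by rewrite /bform linearD /= !mulmxDl mxE. Qed.
Lemma bformDr M x y z : bform M z (x + y) = bform M z x + bform M z y.
Proof. by rewrite /bform mulmxDr mxE. Qed.
Lemma bformNl M x y : bform M (- x) y = - bform M x y.
Proof. by rewrite /bform linearN /= !mulNmx mxE. Qed.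
Lemma bformNr M x y : bform M x (- y) = - bform M x y.
Proof. by rewrite /bform mulmxN mxE. Qed.
Lemma bformZl M (a : int) x y : bform M (a *: x) y = a * bform M x y.
Proof. by rewrite /bform linearZ /= -!scalemxAl mxE. Qed.
Lemma bformZr M (a : int) x y : bform M x (a *: y) = a * bform M x y.
Proof. by rewrite /bform -scalemxAr mxE. Qed.

Lemma bformC M x y : M^T = M -> bform M x y = bform M y x.
Proof.
move=> MT; rewrite /bform.
have -> : x^T *m M *m y = (y^T *m M *m x)^T by rewrite !trmx_mul trmxK MT mulmxA.
by rewrite mxE.
Qed.

Lemma bform_mul M E x y : bform M (E *m x) (E *m y) = bform (E^T *m M *m E) x y.
Proof. by rewrite /bform trmx_mul !mulmxA. Qed.

Lemma bform_delta M i j : bform M (delta_mx i 0) (delta_mx j 0) = M i j.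
Proof. by rewrite /bform trmx_delta -rowE -colE !mxE. Qed.

Lemma bform_col M E i j : bform M (col i E) (col j E) = (E^T *m M *m E) i j.
Proof. by rewrite !colE bform_mul bform_delta. Qed.

Definition symmetrizes d A : Prop :=
  (forall i, 0 < d 0 i) /\ forall i j, d 0 i * A i j = d 0 j * A j i.

Lemma symmetrized_tr d A : symmetrizes d A -> (symmetrized d A)^T = symmetrized d A.
Proof. by move=> [_ dA]; apply/matrixP => i j; rewrite mxE !symmetrizedE. Qed.

Lemma even_symmetric_sum (f : 'I_n -> 'I_n -> int) :
  (forall i j, f i j = f j i) -> (forall i, (2 %| f i i)%Z) ->
  (2 %| \sum_i \sum_j f i j)%Z.
Proof.
move=> fC fi.
have -> : \sum_i \sum_j f i j =
    \sum_i f i i + 2 * \sum_(i < n) \sum_(j < n | (i < j)%N) f i j.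
  have -> : \sum_i \sum_j f i j = \sum_i f i i +
     (\sum_(i < n) \sum_(j < n | (i < j)%N) f i j +
      \sum_(i < n) \sum_(j < n | (j < i)%N) f i j).
    rewrite -!big_split /=; apply: eq_bigr => i _.
    rewrite (bigD1 i) //=; congr (_ + _).
    rewrite (bigID (fun j : 'I_n => (i < j)%N)) /=; congr (_ + _).
      by apply: eq_bigl => j; rewrite -val_eqE /=; case: ltngtP.
    by apply: eq_bigl => j; rewrite -val_eqE /=; case: ltngtP.
  congr (_ + _); rewrite mulr2n mulrDl !mul1r; congr (_ + _).
  rewrite (exchange_big_dep xpredT) //=.
  by apply: eq_bigr => i _; apply: eq_bigr => j _.
apply: rpredD; last exact: dvdz_mulr.
by apply: rpred_sum => i _.
Qed.

(** The rows of the symmetrized matrix allow to extract the factor c, and a symmetric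
double sum with even diagonal terms is even. So the form takes no value strictly
between 0 and 2 c on the vectors with coroot coordinates divisible by c. *)
Lemma bform_dvd d A (c : int) y : symmetrizes d A -> (forall i, A i i = 2) ->
  0 < c -> (forall i, (c %| d 0%R i * y i 0%R)%Z) ->
  (2 * c %| bform (symmetrized d A) y y)%Z.
Proof.
move=> [d0 dA] Aii c0 cy.
pose z i := (d 0%R i * y i 0%R %/ c)%Z.
have zE i : d 0 i * y i 0 = z i * c by rewrite divzK.
have -> : bform (symmetrized d A) y y = (\sum_i \sum_j z i * A i j * y j 0) * c.
  rewrite bformE mulr_suml; apply: eq_bigr => i _.
  rewrite mulr_suml; apply: eq_bigr => j _; rewrite symmetrizedE.
  by rewrite mulrA [y i 0 * _]mulrC zE; ring.
rewrite dvdz_mul //; apply: even_symmetric_sum => [i j|i].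
  apply: (mulIf (lt0r_neq0 c0)).
  have -> : z i * A i j * y j 0 * c = d 0 i * A i j * y i 0 * y j 0.
    by transitivity (z i * c * A i j * y j 0); [ring|rewrite -zE; ring].
  have -> : z j * A j i * y i 0 * c = d 0 j * A j i * y i 0 * y j 0.
    by transitivity (z j * c * A j i * y i 0); [ring|rewrite -zE; ring].
  by rewrite dA.
by rewrite Aii mulrAC dvdz_mull.
Qed.

Definition cartan_like d A : Prop :=
  [/\ symmetrizes d A, positive_definite (symmetrized d A),
      forall i, A i i = 2 & forall i j, i != j -> A i j <= 0].

(** Write x = p - q with p and q nonnegative and of disjoint supports. The entries of A
off the diagonal are nonpositive, hence the norm of x is at least the sum of those of
p and q. By [bform_dvd] each of these is at least 2 c unless it is 0, but their sum is
at most 2 c. *)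
Lemma root_sign_coherent d A (c : int) x : cartan_like d A ->
  0 < c -> (forall i, (c %| d 0%R i * x i 0%R)%Z) ->
  bform (symmetrized d A) x x = 2 * c ->
  (forall i, 0 <= x i 0) \/ (forall i, x i 0 <= 0).
Proof.
move=> [dA pos Aii Aij] c0 cx Qx; have [d0 _] := dA.
pose p : 'cV[int]_n := \col_i (if 0 <= x i 0 then x i 0 else 0).
pose q : 'cV[int]_n := \col_i (if 0 <= x i 0 then 0 else - x i 0).
have xE : x = p - q.
  apply/matrixP => i j; rewrite !ord1 !mxE.
  by case: ifP; rewrite ?subr0 ?sub0r ?opprK.
have p0 i : 0 <= p i 0 by rewrite mxE; case: ifP.
have q0 i : 0 <= q i 0.
  by rewrite mxE; case: ifP => [//|/negbT]; rewrite -ltNge oppr_ge0 => /ltW.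
have pq i : p i 0 * q i 0 = 0 by rewrite !mxE; case: ifP; rewrite ?mulr0 ?mul0r.
set M := symmetrized d A in Qx.
have S0 : bform M p q <= 0.
  rewrite bformE; apply: sumr_le0 => i _; apply: sumr_le0 => j _.
  have [<-|ij] := eqVneq i j; first by rewrite mulrAC pq mul0r.
  rewrite mulrAC mulr_ge0_le0 ?mulr_ge0 // symmetrizedE.
  by rewrite pmulr_rle0 // Aij.
have bound y : (forall i, y i 0 = x i 0 \/ y i 0 = 0 \/ y i 0 = - x i 0) ->
    y != 0 -> 2 * c <= bform M y y.
  move=> yx y0; have Q0 : 0 < bform M y y by exact: pos.
  have /dvdzP [k kE] : (2 * c %| bform M y y)%Z.
    apply: bform_dvd => // i.
    by case: (yx i) => [->|[->|->]]; rewrite ?mulr0 ?dvdz0 ?mulrN ?rpredN ?cx.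
  have c20 : 0 < 2 * c by rewrite mulr_gt0.
  by move: Q0; rewrite kE pmulr_lgt0 // => k0; apply: ler_peMl; [exact: ltW|lia].
case: (eqVneq p 0) => [p00|pn0].
  right=> i; rewrite xE p00 sub0r mxE oppr_le0; exact: q0.
case: (eqVneq q 0) => [q00|qn0].
  by left=> i; rewrite xE q00 subr0.
have bp : 2 * c <= bform M p p.
  by apply: bound => // i; rewrite mxE; case: ifP; auto.
have bq : 2 * c <= bform M q q.
  by apply: bound => // i; rewrite mxE; case: ifP; auto.
move: Qx; rewrite xE bformDl !bformDr !bformNl !bformNr (bformC q p); last first.
  exact: symmetrized_tr.
lia.
Qed.

Lemma positive_definite_det M : positive_definite M -> \det M != 0.
Proof.
move=> pos; apply/det0P => -[v v0 vM].
have vT0 : v^T != 0 by rewrite -(trmx0 _ 1 n) (inj_eq (@trmx_inj _ _ _)).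
by have := pos _ vT0; rewrite trmxK vM mul0mx mxE ltxx.
Qed.

(** For a multiple N of d this is a dominant vector: its products with the basis
vectors are N times half their norms. Clearing denominators avoids rational
vectors. *)
Lemma regular_vector d M : positive_definite M ->
  exists v N, 0 < N /\ M *m v = (N *: d)^T.
Proof.
move=> pos; exists (\adj M *m (\det M *: d)^T), (\det M * \det M).
split; first by have := positive_definite_det pos; nia.
by rewrite mulmxA mul_mx_adj mul_scalar_mx !linearZ /= scalerA.
Qed.

(** * Conjugacy of simple systems *)

Definition simple_reflection A (i : 'I_n) : 'M[int]_n :=
  1%:M - delta_mx i 0 *m row i A.

Lemma simple_reflection_mul A i x :
  simple_reflection A i *m x = x - (A *m x) i 0 *: delta_mx i 0.
Proof.
rewrite mulmxBl mul1mx -mulmxA -row_mul; congr (_ - _).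
apply/matrixP => a b; rewrite !ord1 mxE big_ord1 !mxE.
by rewrite mulrC.
Qed.

Lemma simple_reflectionK A i : A i i = 2 ->
  simple_reflection A i *m simple_reflection A i = 1%:M.
Proof.
move=> Aii; rewrite /simple_reflection.
have rk : row i A *m delta_mx i 0 = 2%:M :> 'M_1.
  by apply/matrixP => a b; rewrite !ord1 -colE !mxE Aii.
set N := _ *m row i A.
have NN : N *m N = N + N.
  by rewrite /N mulmxA -(mulmxA (delta_mx i 0)) rk mul_mx_scalar -scalemxAl
    scaler_nat mulr2n.
by rewrite mulmxBl mul1mx mulmxBr mulmx1 NN opprB addrK subrK.
Qed.

Lemma dual_integral_reflection d A i : symmetrizes d A ->
  dual_integral d d (simple_reflection A i).
Proof.
move=> [_ dA] a b; rewrite mxE [X in _ + X]mxE mulrBr; apply: rpredB.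
  exact: dual_integral1.
rewrite mxE big_ord1 !mxE; case: eqVneq => [->|_] /=.
  by rewrite mul1r dA dvdz_mulr.
by rewrite mul0r mulr0 dvdz0.
Qed.

Lemma simple_reflection_form d A i : symmetrizes d A -> A i i = 2 ->
  (simple_reflection A i)^T *m symmetrized d A *m simple_reflection A i =
  symmetrized d A.
Proof.
move=> dA Aii; apply/matrixP => a b; rewrite -bform_delta -bform_mul.
rewrite !simple_reflection_mul -!colE !bformDl !bformDr !bformNl !bformNr !bformZl.
rewrite !bformZr !bform_delta !symmetrizedE !mxE Aii.
have [_ E] := dA; rewrite (E a i); ring.
Qed.

Definition lattice_isometry d A e A' E E' : Prop :=
  [/\ E *m E' = 1%:M, E^T *m symmetrized d A *m E = symmetrized e A',
      dual_integral d e E & dual_integral e d E'].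

Lemma lattice_isometry_sym d A e A' E E' :
  lattice_isometry d A e A' E E' -> lattice_isometry e A' d A E' E.
Proof.
move=> [EE' EM dE dE']; split=> //; first exact: mulmx1C.
by rewrite -EM !mulmxA -trmx_mul EE' trmx1 mul1mx -mulmxA EE' mulmx1.
Qed.

Lemma lattice_isometry_column d A e A' E E' j :
  cartan_like d A -> cartan_like e A' -> lattice_isometry d A e A' E E' ->
  (forall i, 0 <= E i j) \/ (forall i, E i j <= 0).
Proof.
move=> cA [[e0 _] _ Aii' _] [_ EM dE _].
have [|||H|H] := @root_sign_coherent d A (e 0 j) (col j E) cA.
- exact: e0.
- by move=> i; rewrite mxE; exact: dE.
- by rewrite bform_col EM symmetrizedE Aii' mulrC.
- by left=> i; have := H i; rewrite mxE.
- by right=> i; have := H i; rewrite mxE.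
Qed.

Lemma lattice_isometry_reflection d A e A' E E' i :
  symmetrizes d A -> A i i = 2 -> lattice_isometry d A e A' E E' ->
  lattice_isometry d A e A'
    (simple_reflection A i *m E) (E' *m simple_reflection A i).
Proof.
move=> dA Aii [EE' EM dE dE']; split.
- by rewrite !mulmxA -(mulmxA _ E) EE' mulmx1 simple_reflectionK.
- rewrite -EM -[in RHS](simple_reflection_form dA Aii).
  by rewrite trmx_mul !mulmxA.
- exact: dual_integral_mul (dual_integral_reflection i dA) dE.
- exact: dual_integral_mul dE' (dual_integral_reflection i dA).
Qed.

(** Let v and w be dominant vectors for the two bases. If some column of E', i.e. some
basis root a_i in terms of the other basis, is negative, then (a_i, E w) < 0, and
the reflection in a_i brings E w strictly closer to v. As the squared distance is a
nonnegative integer, this stops. *)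
Lemma lattice_isometry_nonneg d A e A' E E' :
  cartan_like d A -> cartan_like e A' -> lattice_isometry d A e A' E E' ->
  exists E1 E1', lattice_isometry d A e A' E1 E1' /\ forall i j, 0 <= E1' i j.
Proof.
move=> cA cA' iso; have [dA pos Aii Aij] := cA; have [d0 dAE] := dA.
have [[e0 _] pos' _ _] := cA'.
have [v [N [N0 Mv]]] := regular_vector d pos.
have [w [N' [N0' Mw]]] := regular_vector e pos'.
set M := symmetrized d A in Mv pos *.
pose Q F := bform M (v - F *m w) (v - F *m w).
have Q0 F : 0 <= Q F.
  rewrite /Q; case: (eqVneq (v - F *m w) 0) => [->|x0].
    by rewrite bformE big1 // => i _; rewrite big1 // => j _; rewrite mxE !mul0r.
  by apply: ltW; exact: pos.
have [m] := ubnP `|Q E|%N; elim: m E E' iso => // m IH E E' iso Qm.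
case: (boolP [forall i, forall j, 0 <= E' i j]) => [/forallP H|].
  by exists E, E'; split=> // i j; have /forallP := H i.
rewrite negb_forall => /existsP [j0]; rewrite negb_forall => /existsP [i Eji].
have [H|H] := lattice_isometry_column i cA' cA (lattice_isometry_sym iso).
  by rewrite H in Eji.
apply: (IH _ _ (lattice_isometry_reflection dA (Aii i) iso)).
have [EE' EM _ _] := iso.
pose t := (A *m (E *m w)) i 0.
have ME : M *m (E *m w) = E'^T *m (N' *: e)^T.
  rewrite -Mw -EM !mulmxA -trmx_mul.
  by rewrite EE' trmx1 mul1mx.
have dt : d 0 i * t = \sum_j E' j i * (N' * e 0 j).
  have <- : (M *m (E *m w)) i 0 = d 0 i * t.
    rewrite /t !mxE mulr_sumr; apply: eq_bigr => l _.
    by rewrite symmetrizedE mulrA.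
  by rewrite ME mxE; apply: eq_bigr => j _; rewrite !mxE.
have t0 : t < 0.
  rewrite -(pmulr_rlt0 _ (d0 i)) dt (bigD1 j0) //=.
  apply: ltr_wnDr; last by rewrite pmulr_llt0 ?mulr_gt0 // ltNge.
  by apply: sumr_le0 => j _; rewrite pmulr_lle0 ?mulr_gt0.
(* The reflection moves E w by - t a_i, and (v, a_i) = N d_i is positive. *)
have QS : Q (simple_reflection A i *m E) = Q E + 2 * (t * (N * d 0 i)).
  rewrite /Q -mulmxA simple_reflection_mul -/t.
  set y := E *m w; set a := delta_mx i 0.
  have va : bform M v a = N * d 0 i.
    by rewrite bformC ?symmetrized_tr // /bform -mulmxA Mv trmx_delta -rowE !mxE.
  have ya : bform M y a = d 0 i * t.
    rewrite bformC ?symmetrized_tr // /bform -mulmxA trmx_delta -rowE mxE.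
    by rewrite ME dt mxE; apply: eq_bigr => j _; rewrite !mxE.
  have aa : bform M a a = 2 * d 0 i by rewrite bform_delta symmetrizedE Aii mulrC.
  rewrite !opprB !(bformDl, bformDr, bformNl, bformNr, bformZl, bformZr).
  rewrite !(bformC a) ?symmetrized_tr // va ya aa; ring.
have := Q0 E; have := Q0 (simple_reflection A i *m E).
have : 2 * (t * (N * d 0 i)) < 0.
  by rewrite pmulr_rlt0 // pmulr_llt0 // mulr_gt0.
move: Qm QS; lia.
Qed.

(** Once E' is nonnegative, so is E, because its columns have constant sign and
E' E = 1. Two nonnegative integral matrices that are inverse to each other are
permutation matrices. *)
Lemma lattice_isometry_cartan_type d A e A' E E' :
  cartan_like d A -> cartan_like e A' -> lattice_isometry d A e A' E E' ->
  same_cartan_killing_type A' A.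
Proof.
move=> cA cA' /(lattice_isometry_nonneg cA cA') [F [F' [iso F'0]]].
have [FF' FM _ _] := iso; have F'F := mulmx1C FF'.
have sum1 j : \sum_l F' j l * F l j = 1.
  by have /matrixP/(_ j j) := F'F; rewrite !mxE eqxx.
have F0 i j : 0 <= F i j.
  have [//|H] := lattice_isometry_column j cA cA' iso.
  have := sum1 j; suff : \sum_l F' j l * F l j <= 0 by lia.
  by apply: sumr_le0 => l _; apply: mulr_ge0_le0.
have F'F0 j l j' : j' != j -> F' j l * F l j' = 0.
  move=> jj'; have /matrixP/(_ j j') := F'F.
  rewrite !mxE eq_sym (negPf jj') => /eqP.
  rewrite psumr_eq0 => [|k _]; last exact: mulr_ge0.
  by move=> /allP /(_ l); rewrite mem_index_enum => /(_ isT) /eqP.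
have ex j : {l | F' j l * F l j != 0}.
  apply/sigW; case: (boolP [exists l, F' j l * F l j != 0]) => [/existsP //|].
  rewrite negb_exists => /forallP H; have := sum1 j.
  by rewrite big1 // => l _; have := H l; rewrite negbK => /eqP.
pose s j := val (ex j).
have Fs j : F' j (s j) != 0 /\ F (s j) j != 0.
  by have := valP (ex j); rewrite mulf_eq0 negb_or => /andP[].
have Fs0 j j' : j' != j -> F (s j) j' = 0.
  move=> jj'; have /eqP := F'F0 j (s j) j' jj'.
  by rewrite mulf_eq0 (negPf (Fs j).1) => /eqP.
have s_inj : injective s.
  move=> j j' ss; apply/eqP/negPn/negP => jj'.
  by have := (Fs j).2; rewrite ss Fs0 ?eqxx.
have s_bij : bijective s by exact: injF_bij.
have FE l j : l != s j -> F l j = 0.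
  have [t st ts] := s_bij; rewrite -(ts l) => lj; apply: Fs0.
  by apply: contra_neq lj => ->.
have F1 j : F (s j) j = 1.
  have := sum1 j; rewrite (bigD1 (s j)) //= big1 => [|l lj]; last first.
    by rewrite FE ?mulr0.
  rewrite addr0; have := (Fs j).1; have := (Fs j).2.
  have := F0 (s j) j; have := F'0 j (s j).
  nia.
have FMs i j : e 0 i * A' i j = d 0 (s i) * A (s i) (s j).
  rewrite -!symmetrizedE -FM -bform_col bformE.
  rewrite (bigD1 (s i)) //= [X in _ + X]big1 => [|l li]; last first.
    by rewrite big1 // => k _; rewrite mxE FE // !mul0r.
  rewrite (bigD1 (s j)) //= [X in _ + X + _]big1 => [|l lj]; last first.
    by rewrite [col j F _ _]mxE FE // mulr0.
  by rewrite !mxE !F1 mul1r mulr1 !addr0.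
have [[e0 _] _ Aii' _] := cA'; have [_ _ Aii _] := cA.
exists s => // i j; have := FMs i i; rewrite Aii Aii' => /(mulIf _) ed.
by have := FMs i j; rewrite -ed // => /(mulfI (lt0r_neq0 (e0 i))).
Qed.
End Lattice.

(** * Root bases that are congruent to the exchange matrix modulo 2 *)

Definition parity_eq (x y : int) : Prop := x%:~R = y%:~R :> 'F_2.

Lemma F2_addrr (a : 'F_2) : a + a = 0.
Proof. exact: (addrr_pchar2 (pchar_Fp (isT : prime 2))). Qed.

Lemma F2_oppr (a : 'F_2) : - a = a.
Proof. exact: (oppr_pchar2 (pchar_Fp (isT : prime 2))). Qed.

Section Companion.
Variable n : nat.
Implicit Types (d e : 'rV[int]_n) (A B E G M : 'M[int]_n).

(** The columns of E are a basis of the lattice of A that consists of roots of norms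
2 e_i, and G is its matrix of Cartan integers. Unlike for a quasi-Cartan companion,
G and B are only required to agree modulo 2: this weaker relation is preserved by
every mutation. The vector e, which symmetrizes both, carries the information on
lengths that is lost modulo 2. *)
Definition root_companion d A B : Prop :=
  exists e G E E',
    [/\ skew_symmetrized_by (e 0) B, lattice_isometry d A e G E E',
        forall i, G i i = 2 & forall i j, parity_eq (G i j) (B i j)].

Section Step.
Variables (e : 'rV[int]_n) (B G : 'M[int]_n) (k : 'I_n).

(** The Cartan integers by which multiples of the k-th root are subtracted: only the
roots with b_ik > 0 are reflected. *)
Definition reflect_row (H : 'M[int]_n) : 'rV[int]_n :=
  \row_i (if 0 < B i k then H k i else 0).

(** The change of basis for c = -1, and its inverse for c = 1; the two cancel because
the k-th root itself is not moved. *)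
Definition reflect_step (c : int) : 'M[int]_n :=
  1%:M + c *: (delta_mx k 0 *m reflect_row G).

(** The Cartan integers of the new basis. They are defined by this formula, and not as
a matrix product, because the division by e has to be exact. *)
Definition reflected_gram : 'M[int]_n := \matrix_(i, j)
  (G i j - G i k * reflect_row G 0 j
   - reflect_row G^T 0 i * (G k j - G k k * reflect_row G 0 j)).

Hypothesis eB : skew_symmetrized_by (e 0) B.
Hypothesis Gii : forall i, G i i = 2.
Hypothesis GB : forall i j, parity_eq (G i j) (B i j).
Hypothesis eG : forall i j, e 0 i * G i j = e 0 j * G j i.

Let Bkk : B k k = 0. Proof. exact: skew_symmetrized_diag eB. Qed.

Lemma reflect_row_k H : reflect_row H 0 k = 0.
Proof. by rewrite mxE Bkk ltxx. Qed.

Lemma reflect_stepE (X : 'M[int]_n) c i j :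
  (X *m reflect_step c) i j = X i j + c * (X i k * reflect_row G 0 j).
Proof.
rewrite mulmxDr mulmx1 -scalemxAr mulmxA -colE mxE [X in _ + X]mxE; congr (_ + _ * _).
by rewrite mxE big_ord1 mxE.
Qed.

Lemma reflect_stepK : reflect_step (-1) *m reflect_step 1 = 1%:M.
Proof.
have rk : reflect_row G *m delta_mx k 0 = 0 :> 'M_1.
  by apply/matrixP => a b; rewrite !ord1 -colE mxE reflect_row_k mxE.
rewrite /reflect_step scale1r scaleN1r; set N := delta_mx k 0 *m _.
have NN : N *m N = 0 by rewrite /N mulmxA -(mulmxA (delta_mx k 0)) rk mulmx0 mul0mx.
by rewrite mulmxDl mul1mx mulmxDr mulmx1 mulNmx NN oppr0 addr0 addrK.
Qed.

Lemma reflect_step_integral c : dual_integral e e (reflect_step c).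
Proof.
move=> i j; rewrite -[reflect_step c]mul1mx reflect_stepE mulrDr.
apply: rpredD; first exact: dual_integral1.
rewrite [1%:M i k]mxE [reflect_row _ _ _]mxE; case: eqVneq => [->|_] /=; last first.
  by rewrite mul0r !mulr0 dvdz0.
rewrite mul1r; case: ifP => _; last by rewrite !mulr0 dvdz0.
by rewrite mulrCA eG dvdz_mull // dvdz_mulr.
Qed.

Lemma reflect_step_gram :
  (reflect_step (-1))^T *m symmetrized e G *m reflect_step (-1) =
  symmetrized e reflected_gram.
Proof.
have eGT : (symmetrized e G)^T = symmetrized e G.
  by apply/matrixP => i j; rewrite mxE !symmetrizedE.
apply/matrixP => i j; rewrite reflect_stepE.
have E l : ((reflect_step (-1))^T *m symmetrized e G) i l =
    symmetrized e G i l - symmetrized e G l k * reflect_row G 0 i.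
  have -> : (reflect_step (-1))^T *m symmetrized e G =
      (symmetrized e G *m reflect_step (-1))^T by rewrite trmx_mul eGT.
  by rewrite mxE reflect_stepE mulN1r !symmetrizedE eG.
rewrite !E !symmetrizedE mulN1r [reflected_gram i j]mxE.
have ek : e 0 k * reflect_row G 0 i = e 0 i * reflect_row G^T 0 i.
  by rewrite !mxE; case: ifP => _; rewrite ?mulr0 // eG.
have Ejk : e 0 j * G j k = e 0 k * G k j by rewrite eG.
rewrite Ejk -[e 0 k * G k j * _]mulrAC ek -[e 0 k * G k k * _]mulrAC ek.
ring.
Qed.

Lemma reflected_gram_diag i : reflected_gram i i = 2.
Proof.
rewrite !mxE Gii; case: ifP => _; rewrite Gii; ring.
Qed.

(** If both or neither of the i-th and j-th roots are reflected, their Cartan integer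
does not change; if one of them is, it changes by the product of the entries at
(i, k) and (k, j). Modulo 2 this is the mutation rule: its correction term is
nonzero exactly if b_ik and b_kj have the same sign, so that one of b_ik and b_jk is
positive and the other one is negative. If b_ik or b_kj is 0, the product is
even. *)
Lemma reflected_gram_parity i j :
  parity_eq (reflected_gram i j) (matrix_mutation k B i j).
Proof.
have sg u v := skew_symmetrized_sign u v eB.
rewrite /parity_eq matrix_mutationE !mxE.
have rk : (G k k)%:~R = 0 :> 'F_2 by rewrite Gii; apply/val_inj.
have [->|ik] := eqVneq i k.
  rewrite Bkk ltxx mul0r subr0 /=; case: ifP => _; rewrite ?mulr0 ?subr0.
    by rewrite rmorphB rmorphM /= rk mul0r subr0 rmorphN F2_oppr /= GB.
  by rewrite rmorphN F2_oppr GB.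
have [->|jk] := eqVneq j k.
  rewrite Bkk ltxx !mulr0 !subr0 /= rmorphB rmorphN F2_oppr.
  by case: ifP => _; rewrite ?mul0r ?rmorphM ?rmorph0 /= ?rk ?mulr0 addr0 -?GB ?F2_oppr.
rewrite /= /mutation_term (sg j k).
have [x0|x0|x0] := ltrgt0P (B i k); have [y0|y0|y0] := ltrgt0P (B k j);
  rewrite /= ?(rmorphD, rmorphB, rmorphM, rmorphN, rmorph0) /= ?rk !GB
    ?x0 ?y0 ?rmorph0 ?(F2_oppr, mulr0, mul0r, addr0, add0r) //.
by rewrite -addrA F2_addrr addr0.
Qed.

End Step.

Lemma lattice_isometry_gram_sym d A e G E E' : symmetrizes d A ->
  lattice_isometry d A e G E E' -> forall i j, e 0 i * G i j = e 0 j * G j i.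
Proof.
move=> dA [_ EM _ _] i j; rewrite -!symmetrizedE -EM -!bform_col bformC //.
exact: symmetrized_tr.
Qed.

Lemma root_companion_mutation d A B k : symmetrizes d A ->
  root_companion d A B -> root_companion d A (matrix_mutation k B).
Proof.
move=> dA [e [G [E [E' [eB iso Gii GB]]]]].
have eG := lattice_isometry_gram_sym dA iso; have [EE' EM dE dE'] := iso.
exists e, (reflected_gram B G k), (E *m reflect_step B G k (-1)),
  (reflect_step B G k 1 *m E').
split; first exact: skew_symmetrized_mutation.
- split.
  + by rewrite mulmxA -(mulmxA E) (reflect_stepK G k eB) mulmx1.
  + by rewrite -(reflect_step_gram B k eG) -EM trmx_mul !mulmxA.
  + exact: dual_integral_mul dE (reflect_step_integral _ _ eG _).
  + exact: dual_integral_mul (reflect_step_integral _ _ eG _) dE'.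
- exact: reflected_gram_diag.
- exact: (reflected_gram_parity k eB Gii GB).
Qed.

Lemma root_companion_relabel d A B B' (s : 'I_n -> 'I_n) : bijective s ->
  (forall i j, B' (s i) (s j) = B i j) ->
  root_companion d A B -> root_companion d A B'.
Proof.
move=> [t st ts] BE [e [G [E [E' [[e0 eB] [EE' EM dE dE'] Gii GB]]]]].
have B'E i j : B' i j = B (t i) (t j) by rewrite -BE !ts.
exists (colsub t e), (mxsub t t G), (colsub t E), (rowsub t E'); split.
- by split=> [i|i j]; rewrite !mxE ?B'E.
- split.
  + apply: mulmx1C; rewrite -mxsub_mul (mulmx1C EE').
    by apply/matrixP => i j; rewrite !mxE (inj_eq (can_inj ts)).
  + have -> : (colsub t E)^T = rowsub t E^T by apply/matrixP => i j; rewrite !mxE.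
    have -> : rowsub t E^T *m symmetrized d A = rowsub t (E^T *m symmetrized d A).
      by rewrite -mul_rowsub_mx.
    rewrite -mxsub_mul EM; apply/matrixP => i j.
    by rewrite mxE !symmetrizedE !mxE.
  + by move=> i j; rewrite !mxE; exact: dE.
  + by move=> i j; rewrite !mxE; exact: dE'.
- by move=> i; rewrite mxE.
- by move=> i j; rewrite mxE B'E.
Qed.

Lemma root_companion_initial d B : symmetrizes d (cartan_counterpart B) ->
  sign_skew_symmetric B -> root_companion d (cartan_counterpart B) B.
Proof.
move=> [d0 dA] sB.
exists d, (cartan_counterpart B), 1%:M, 1%:M; split.
- split=> // i j; have := dA i j; rewrite !mxE.
  have := d0 i; have := d0 j; have := sB i j.
  have [->|ij] := eqVneq i j; first by case; nia.
  case=> [[-> ->]|]; first by rewrite !mulr0 oppr0.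
  by have [x0|x0|->] := ltrgt0P (B i j); have [y0|y0|->] := ltrgt0P (B j i); nia.
- split; rewrite ?mulmx1 ?trmx1 ?mul1mx //; exact: dual_integral1.
- by move=> i; rewrite mxE eqxx.
- move=> i j; rewrite /parity_eq mxE; case: eqVneq => [->|_].
    suff -> : B j j = 0 by apply/val_inj.
    by have := sB j j; case=> [[]|] //; nia.
  rewrite rmorphN F2_oppr /=.
  by case: (ger0P (B i j)) => _ //; rewrite rmorphN F2_oppr.
Qed.

Lemma positive_definite_isometry d A e G E E' :
  positive_definite (symmetrized d A) -> lattice_isometry d A e G E E' ->
  positive_definite (symmetrized e G).
Proof.
move=> pos [EE' <- _ _] v v0.
have : E *m v != 0.
  apply: contra_neq v0 => Ev.
  by rewrite -[v]mul1mx -(mulmx1C EE') -mulmxA Ev mulmx0.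
move/pos; rewrite trmx_mul !mulmxA; exact.
Qed.

(** Evaluate the form at 2 a_j - g_ij a_i, a multiple of the projection of a_j to the
orthogonal complement of a_i. *)
Lemma positive_definite_product e G i j :
  symmetrizes e G -> positive_definite (symmetrized e G) ->
  (forall i, G i i = 2) -> i != j -> G i j * G j i < 4.
Proof.
move=> eG pos Gii ij; have [e0 eGE] := eG.
pose v : 'cV[int]_n := 2 *: delta_mx j 0 - G i j *: delta_mx i 0.
have v0 : v != 0.
  apply/eqP => /matrixP /(_ j 0); rewrite !mxE !eqxx andbT.
  by rewrite [j == i]eq_sym (negPf ij) mulr0 subr0.
have : 0 < bform (symmetrized e G) v v by exact: pos.
rewrite !(bformDl, bformDr, bformNl, bformNr, bformZl, bformZr) !bform_delta.
rewrite !symmetrizedE !Gii (eGE i j).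
set Q := (Q in 0 < Q); have -> : Q = 2 * e 0 j * (4 - G i j * G j i).
  transitivity (8 * e 0 j - 4 * G i j * (e 0 j * G j i)
    + 2 * G i j * (e 0 i * G i j)); first by rewrite /Q; ring.
  by rewrite (eGE i j); ring.
by rewrite pmulr_rgt0 ?mulr_gt0 // subr_gt0.
Qed.

Lemma parity_eq_even (a x : int) : parity_eq a x -> (2 %| a - x)%Z.
Proof.
move=> ax; rewrite (dvdz_pcharf (pchar_Fp (isT : prime 2))).
by rewrite rmorphB /= ax subrr.
Qed.

(** The two pairs of opposite entries have the same ratio q : p. If they do not vanish,
one entry of each pair is 1 since the product is less than 4, and the ratio
determines the other one. The parities decide which pairs vanish, since two nonzero
even entries have a product of at least 4. *)
Lemma companion_entry (a b x y p q : int) : 0 < p -> 0 < q ->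
  p * a = q * b -> p * x = q * y -> 0 <= a -> 0 <= b -> 0 <= x -> 0 <= y ->
  a * b < 4 -> x * y < 4 -> (2 %| a - x)%Z -> (2 %| b - y)%Z -> a = x.
Proof.
move=> p0 q0 pa px a0 b0 x0 y0 ab xy ax bY.
(* Eliminating p and q. *)
have ayx : a * y = b * x.
  apply: (mulfI (lt0r_neq0 p0)).
  by rewrite mulrA pa [RHS]mulrCA px; ring.
have [a00|an0] := eqVneq a 0.
  have b00 : b = 0 by nia.
  have [x00|xn0] := eqVneq x 0; first by rewrite a00 x00.
  have yn0 : y != 0 by apply: contraNneq xn0 => y00; nia.
  have x2 : 2 <= x by move: ax; lia.
  have y2 : 2 <= y by move: bY; lia.
  nia.
have bn0 : b != 0 by apply: contraNneq an0 => b00; nia.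
have [x00|xn0] := eqVneq x 0.
  have y00 : y = 0 by nia.
  have a2 : 2 <= a by move: ax; lia.
  have b2 : 2 <= b by move: bY; lia.
  nia.
have yn0 : y != 0 by apply: contraNneq xn0 => y00; nia.
have a3 : a <= 3 by nia. have b3 : b <= 3 by nia.
have x3 : x <= 3 by nia. have y3 : y <= 3 by nia.
have aE : a = 1 \/ a = 2 \/ a = 3 by lia.
have bE : b = 1 \/ b = 2 \/ b = 3 by lia.
by case: aE ab ayx => [->|[->|->]]; case: bE => [->|[->|->]] //; nia.
Qed.

Lemma parity_eq_norm (x : int) : parity_eq `|x| x.
Proof.
by rewrite /parity_eq; case: (ger0P x) => _ //; rewrite rmorphN F2_oppr.
Qed.

Lemma finite_type_cartan_like A : finite_type A -> exists d, cartan_like d A.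
Proof.
move=> fA; have [d [d0 dA pos]] := finite_type_positive_definite fA.
have [[Aii Aij _] _] := fA; exists d; split=> //.
Qed.

Lemma symmetrizes_cartan_counterpart e B :
  skew_symmetrized_by (e 0) B -> symmetrizes e (cartan_counterpart B).
Proof.
move=> eB; have [e0 eBE] := eB; split=> // i j; rewrite !mxE eq_sym.
case: eqVneq => [->//|_]; rewrite !mulrN; congr (- _).
have pe l : `|e 0 l| = e 0 l by rewrite gtr0_norm.
by rewrite -(pe i) -(pe j) -!normrM eBE normrN.
Qed.

Lemma signed_companion_of_parity e B G :
  skew_symmetrized_by (e 0) B -> finite_type (cartan_counterpart B) ->
  symmetrizes e G -> positive_definite (symmetrized e G) ->
  (forall i, G i i = 2) -> (forall i j, parity_eq (G i j) (B i j)) ->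
  signed_companion (cartan_counterpart B) G.
Proof.
move=> eB fB eG pos Gii GB; have [e0 eGE] := eG.
have [d [dA posA Aii Aij]] := finite_type_cartan_like fB.
have [_ eAE] := symmetrizes_cartan_counterpart eB.
have AE i j : i != j -> cartan_counterpart B i j = - `|B i j|.
  by rewrite mxE => /negPf ->.
have pe l : `|e 0 l| = e 0 l by rewrite gtr0_norm.
split=> [i|i j ij]; first by rewrite Aii.
have ji : j != i by rewrite eq_sym.
split; last by rewrite -(pmulr_rgt0 _ (e0 i)) eGE pmulr_rgt0.
rewrite AE // opprK; apply: (@companion_entry _ `|G j i| _ `|B j i| (e 0 i) (e 0 j)).
- exact: e0.
- exact: e0.
- by rewrite -(pe i) -(pe j) -!normrM eGE.
- by apply: oppr_inj; rewrite -!mulrN -!AE.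
- exact: normr_ge0.
- exact: normr_ge0.
- exact: normr_ge0.
- exact: normr_ge0.
- rewrite -normrM ger0_norm; first exact: (positive_definite_product eG).
  by rewrite -(pmulr_rge0 _ (e0 i)) mulrA eGE -mulrA pmulr_rge0 // -expr2 sqr_ge0.
- by rewrite -mulrNN -!AE //; exact: (positive_definite_product dA).
- apply: parity_eq_even; rewrite /parity_eq.
  by rewrite [LHS]parity_eq_norm [RHS]parity_eq_norm GB.
- apply: parity_eq_even; rewrite /parity_eq.
  by rewrite [LHS]parity_eq_norm [RHS]parity_eq_norm GB.
Qed.

Lemma lattice_isometry_signs d A e G (H : 'M[int]_n) E E' (c : 'I_n -> int) :
  (forall i, c i = 1 \/ c i = -1) -> (forall i j, c i * c j * G i j = H i j) ->
  lattice_isometry d A e G E E' ->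
  lattice_isometry d A e H (E *m diag_mx (\row_i c i)) (diag_mx (\row_i c i) *m E').
Proof.
move=> c1 cH [EE' EM dE dE']; set S := diag_mx _.
have SE i j : S i j = c i *+ (i == j) by rewrite !mxE.
have SS : S *m S = 1%:M.
  apply/matrixP => i j; rewrite mul_diag_mx !mxE.
  by case: (c1 i) => ->; case: eqVneq; rewrite ?mulr0 //= ?mulr1n ?mulrNN ?mulr1.
have eS : dual_integral e e S.
  move=> i j; rewrite SE; case: eqVneq => [->|_]; last by rewrite mulr0 dvdz0.
  by rewrite dvdz_mulr.
split.
- by rewrite mulmxA -(mulmxA E) SS mulmx1.
- have -> : (E *m S)^T *m symmetrized d A *m (E *m S) = S *m symmetrized e G *m S.
    by rewrite trmx_mul tr_diag_mx -EM !mulmxA.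
  apply/matrixP => i j; rewrite mul_mx_diag mxE mul_diag_mx mxE !symmetrizedE.
  by rewrite !mxE -cH; ring.
- exact: dual_integral_mul dE eS.
- exact: dual_integral_mul eS dE'.
Qed.

Lemma root_companion_cartan_type d A B :
  cartan_like d A -> finite_type (cartan_counterpart B) ->
  root_companion d A B -> same_cartan_killing_type (cartan_counterpart B) A.
Proof.
move=> cA fB [e [G [E [E' [eB iso Gii GB]]]]]; have [dA posA _ _] := cA.
have eG : symmetrizes e G.
  by split; [case: eB|exact: lattice_isometry_gram_sym dA iso].
have posG := positive_definite_isometry posA iso.
have [d' [[d'0 _] posB Bii Bij]] := finite_type_cartan_like fB.
have leafB J := leaf_exists (J := J) d'0 posB Bii Bij.
have [[_ _ B0sym] _] := fB.
have sG := signed_companion_of_parity eB fB eG posG Gii GB.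
have [c [c1 cG]] := signs_exist leafB B0sym [set: 'I_n] sG.
have cG' i j : c i * c j * G i j = cartan_counterpart B i j by exact: cG.
have iso' := lattice_isometry_signs c1 cG' iso.
apply: (lattice_isometry_cartan_type cA _ iso'); split=> //.
  exact: symmetrizes_cartan_counterpart.
exact: positive_definite_isometry posA iso'.
Qed.

End Companion.

Lemma root_companion_related (P : semifieldType) n d (A : 'M[int]_n)
    (S S' : seed P n) : symmetrizes d A -> mutation_related S S' ->
  root_companion d A (exchange_matrix S) ->
  root_companion d A (exchange_matrix S').
Proof.
move=> dA + cS; elim=> [S1 [s sb [_ _ BE]]|S1 S2 k _ cS1 _ /mutationP [_ _ _ _ ->]].
  exact: root_companion_relabel sb BE cS.
exact: root_companion_mutation.
Qed.

Lemma normalized_exists (P : semifieldType) n :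
  exists p : {ffun 'I_n -> P * P}, normalized p.
Proof.
exists [ffun=> normal_pair 1%g]; apply/normalizedP => i.
by rewrite ffunE normal_pair_oplus.
Qed.

Lemma same_cartan_killing_type_sym n n' (A : 'M[int]_n) (A' : 'M[int]_n') :
  same_cartan_killing_type A A' -> same_cartan_killing_type A' A.
Proof.
move=> [s [t st ts] AE]; exists t; first by exists s.
by move=> i j; rewrite -AE !ts.
Qed.

(** * The two directions of the theorem *)

Lemma series_strongly_isomorphic_cartan_type (P : semifieldType) n n'
    (B : 'M[int]_n) (B' : 'M[int]_n') :
  sign_skew_symmetric B ->
  finite_type (cartan_counterpart B) -> finite_type (cartan_counterpart B') ->
  series_strongly_isomorphic P B B' ->
  same_cartan_killing_type (cartan_counterpart B) (cartan_counterpart B').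
Proof.
move=> sB fB fB' [phi _ phiP]; have [p0 np0] := normalized_exists P n.
have [C [C' [CB CB' [f [_ _ [S [S' [CS CS' [s sb [_ _ SE]]]]]]]]]] :=
  phiP (exist _ p0 np0).
have nn' : n = n' by have := bij_eq_card sb; rewrite !card_ord.
subst n'.
have [d cA] := finite_type_cartan_like fB; have [dA _ _ _] := cA.
have c0 : root_companion d (cartan_counterpart B) B.
  exact: root_companion_initial.
have c1 := root_companion_related dA (seed_of_related CB CS) c0.
have c2 := root_companion_relabel sb SE c1.
have c3 := root_companion_related dA (seed_of_related CS' CB') c2.
apply: same_cartan_killing_type_sym.
exact: root_companion_cartan_type cA fB' c3.
Qed.

Lemma cartan_type_series_strongly_isomorphic (P : semifieldType) n n'
    (B : 'M[int]_n) (B' : 'M[int]_n') :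
  sign_skew_symmetric B -> sign_skew_symmetric B' ->
  finite_type (cartan_counterpart B) -> finite_type (cartan_counterpart B') ->
  same_cartan_killing_type (cartan_counterpart B) (cartan_counterpart B') ->
  series_strongly_isomorphic P B B'.
Proof.
move=> sB sB' fB fB' [s sb AE].
have skew m (D : 'M[int]_m) : sign_skew_symmetric D ->
    finite_type (cartan_counterpart D) -> exists d, skew_symmetrized_by d D.
  move=> sD /finite_type_cartan_like [d [dD _ _ _]].
  have [e [G [E [E' [eD _ _ _]]]]] := root_companion_initial dD sD.
  by exists (e 0).
have [d dB] := skew _ _ sB fB; have [d' dB'] := skew _ _ sB' fB'.
pose C : 'M[int]_n := \matrix_(i, j) B' (s i) (s j).
have [e [[e0 _] pos Aii Aij]] := finite_type_cartan_like fB.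
have leafB J := leaf_exists (J := J) e0 pos Aii Aij.
apply: (@series_strongly_isomorphic_of_transfer P n n' B C B' d d' s) => //.
  by move=> i j; rewrite mxE.
apply: (coefficient_transfer_orientations leafB).
  split=> [i j|i j ij]; first exact: (skew_symmetrized_sign i j dB).
  by rewrite mxE (negPf ij) opprK.
split=> [i j|i j ij]; rewrite !mxE; first exact: (skew_symmetrized_sign _ _ dB').
rewrite (negPf ij); have := AE i j.
by rewrite !mxE (inj_eq (bij_inj sb)) (negPf ij) => <-; rewrite opprK.
Qed.

Theorem theorem1p7 (P : semifieldType) (n n' : nat)
    (B : 'M[int]_n) (B' : 'M[int]_n') :
  sign_skew_symmetric B -> sign_skew_symmetric B' ->
  finite_type (cartan_counterpart B) -> finite_type (cartan_counterpart B') ->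
  (series_strongly_isomorphic P B B' <->
   same_cartan_killing_type (cartan_counterpart B) (cartan_counterpart B')).
Proof.
move=> sB sB' fB fB'; split.
  exact: series_strongly_isomorphic_cartan_type.
exact: cartan_type_series_strongly_isomorphic.
Qed.
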